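(* There are universal constants $C>0$ and $c>0$ such that the following holds. Let $d\ge n\ge1$ be integers and $\boldsymbol\lambda\in\mathbb{R}_{++}^d$. If the training data $(\boldsymbol x_1,y_1),\dots,(\boldsymbol x_n,y_n)\in\mathbb{R}^d\times\{-1,+1\}$ follow the Haar features model with model parameter $\boldsymbol\lambda$ (with the general label model), then the probability that every training example is a support vector is at least $$1-\exp\left(-c\cdot d_\infty+Cn\right)-\exp\left(-c\cdot\frac{d-n+1}{d}\cdot\frac{d_\infty}{n}+C\log n\right).$$
   Context: $\mathbb{R}_{++}=\{x\in\mathbb{R}:x>0\}$. Universal constants do not depend on $d$, $n$, or properties of the data distribution. Effective dimension: for $\boldsymbol\lambda\in\mathbb{R}_{++}^d$, $d_\infty:=\|\boldsymbol\lambda\|_1/\|\boldsymbol\lambda\|_\infty$. Feature model (Haar features): $\boldsymbol x_i=\mathrm{diag}(\boldsymbol\lambda)^{1/2}\boldsymbol z_i$ for $i=1,\dots,n$, where the $n\times d$ random matrix $\boldsymbol Z=[\boldsymbol z_1|\cdots|\boldsymbol z_n]^{\mathsf T}$ consists of the first $n$ rows of a uniformly random (Haar-distributed) $d\times d$ orthogonal matrix, scaled by $\sqrt d$. Label model: conditional on $\boldsymbol x_1,\dots,\boldsymbol x_n$, the $y_1,\dots,y_n$ are independent $\{-1,+1\}$-valued random variables such that the conditional distribution of $y_i$ depends only on $\boldsymbol x_i$, i.e., for each $i$, $y_i$ is conditionally independent of $(\boldsymbol x_j,y_j)_{j\ne i}$ given $\boldsymbol x_i$. For the Haar features, this means: conditional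 on all of $\boldsymbol x_1,\dots,\boldsymbol x_n$ the labels are independent, with the law of $y_i$ a function of $\boldsymbol x_i$ only. Support vectors: the (hard-margin, homogeneous) SVM problem is $\min_{\boldsymbol w\in\mathbb{R}^d}\frac12\|\boldsymbol w\|_2^2$ subject to $y_i\boldsymbol x_i^{\mathsf T}\boldsymbol w\ge1$ for all $i$. With $\boldsymbol K$ the $n\times n$ Gram matrix $K_{i,j}=\boldsymbol x_i^{\mathsf T}\boldsymbol x_j$ and $\boldsymbol y=(y_1,\dots,y_n)$, its Lagrangian dual is $\max_{\boldsymbol\alpha\in\mathbb{R}^n}\sum_{i=1}^n\alpha_i-\frac12\boldsymbol\alpha^{\mathsf T}\mathrm{diag}(\boldsymbol y)^{\mathsf T}\boldsymbol K\,\mathrm{diag}(\boldsymbol y)\boldsymbol\alpha$ subject to $\alpha_i\ge0$ for all $i$. The support vectors are the examples $(\boldsymbol x_i,y_i)$ with $\alpha_i^\star>0$, where $\boldsymbol\alpha^\star$ is the optimal dual solution (unique since $\boldsymbol K$ is non-singular here). *)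

(* Defs.v *)
From HB Require Import structures.
From mathcomp Require Import all_boot all_order all_algebra.
From mathcomp Require Import all_classical all_reals all_analysis.

Set Implicit Arguments.
Unset Strict Implicit.
Unset Printing Implicit Defensive.
Import Order.TTheory GRing.Theory Num.Theory.
Import numFieldNormedType.Exports.
Local Open Scope classical_set_scope.
Local Open Scope ring_scope.

(* Product sigma-algebra of the m * n entries. Since R is second countable, it
   is also the Borel sigma-algebra of 'M[R]_(m, n). *)
Definition mx_entry_sets (R : realType) (m n : nat) : set (set 'M[R]_(m, n)) :=
  \bigcup_(ij in [set: 'I_m * 'I_n])
    preimage_set_system setT (fun A : 'M[R]_(m, n) => A ij.1 ij.2) measurable.

Definition measurable_mx (R : realType) (m n : nat) :=
  g_sigma_algebraType (@mx_entry_sets R m n).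
HB.instance Definition _ (R : realType) (m n : nat) :=
  Measurable.on (measurable_mx R m n).

Definition eff_dim (R : realType) (d : nat) (lambda : 'rV[R]_d) : R :=
  (\sum_j `|lambda ord0 j|) / \big[Num.max/0]_j `|lambda ord0 j|.

Definition orthogonal_mx (R : realType) (d : nat) : set 'M[R]_d :=
  [set U | U *m U^T = 1%:M].

(* As O(d) is compact, left invariance determines mu and implies right
   invariance. *)
Definition haar_orthogonal (R : realType) (d : nat)
    (mu : probability (measurable_mx R d d) R) : Prop :=
  mu (@orthogonal_mx R d) = 1%E /\
  forall (Q : 'M[R]_d) (B : set (measurable_mx R d d)),
    orthogonal_mx Q -> measurable B -> mu [set U | B (Q *m U)] = mu B.

Definition scaled_rows (R : realType) (n d : nat) (hnd : (n <= d)%N)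
    (U : 'M[R]_d) : 'M[R]_(n, d) :=
  Num.sqrt d%:R *: rowsub (widen_ord hnd) U.

(* Row i is x_i^T = (diag(lambda)^(1/2) z_i)^T, where z_i^T is row i of Z. *)
Definition feature_mx (R : realType) (n d : nat) (lambda : 'rV[R]_d)
    (Z : 'M[R]_(n, d)) : 'M[R]_(n, d) :=
  Z *m diag_mx (map_mx Num.sqrt lambda).

(* A condition on the law of X alone: the Haar matrix need not live on the
   probability space that carries X and the labels. *)
Definition haar_features (R : realType) (n d : nat) (hnd : (n <= d)%N)
    (lambda : 'rV[R]_d) (disp : measure_display) (T : measurableType disp)
    (P : probability T R) (X : {RV P >-> measurable_mx R n d}) : Prop :=
  exists2 mu : probability (measurable_mx R d d) R, haar_orthogonal mu &
    forall B : set (measurable_mx R n d), measurable B ->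
      distribution P X B =
        mu [set U | B (feature_mx lambda (scaled_rows hnd U))].

(* g o X is a version of the conditional probability of E given X. *)
Definition cond_prob_given (R : realType) (disp disp' : measure_display)
    (T : measurableType disp) (V : measurableType disp')
    (P : probability T R) (X : {RV P >-> V}) (E : set T) (g : V -> R) : Prop :=
  measurable_fun setT g /\
  forall B : set V, measurable B ->
    P (E `&` X @^-1` B) = (\int[P]_(w in X @^-1` B) (g (X w))%:E)%E.

(* eta i x is the conditional probability of y_i = +1 given x_i = x. The product
   form says that, given all the features, the labels are independent and the
   law of y_i is a function of x_i only. *)
Definition label_model (R : realType) (n d : nat) (disp : measure_display)
    (T : measurableType disp) (P : probability T R)
    (X : {RV P >-> measurable_mx R n d}) (y : 'I_n -> {RV P >-> R}) : Prop :=
  (forall i w, y i w = -1 \/ y i w = 1) /\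
  exists eta : 'I_n -> measurable_mx R 1 d -> R,
    (forall i, measurable_fun setT (eta i)) /\
    (forall i x, 0 <= eta i x <= 1) /\
    forall s : 'I_n -> bool,
      cond_prob_given X [set w | forall i, y i w = if s i then 1 else -1]
        (fun A : measurable_mx R n d =>
           \prod_i if s i then eta i (row i A) else 1 - eta i (row i A)).

Definition gram_mx (R : realType) (n d : nat) (X : 'M[R]_(n, d)) : 'M[R]_n :=
  X *m X^T.

Definition dual_objective (R : realType) (n d : nat) (X : 'M[R]_(n, d))
    (y : 'rV[R]_n) (alpha : 'cV[R]_n) : R :=
  \sum_i alpha i ord0 -
  2^-1 * (alpha^T *m (diag_mx y)^T *m gram_mx X *m diag_mx y *m alpha) ord0 ord0.

Definition dual_feasible (R : realType) (n : nat) (alpha : 'cV[R]_n) : Prop :=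
  forall i, 0 <= alpha i ord0.

Definition dual_optimal (R : realType) (n d : nat) (X : 'M[R]_(n, d))
    (y : 'rV[R]_n) (alpha : 'cV[R]_n) : Prop :=
  dual_feasible alpha /\
  forall beta : 'cV[R]_n, dual_feasible beta ->
    dual_objective X y beta <= dual_objective X y alpha.

(* Support vectors refer to the unique dual solution, which exists whenever the
   Gram matrix is non-singular; when there is no unique solution, no example
   counts as a support vector. *)
Definition support_vector (R : realType) (n d : nat) (X : 'M[R]_(n, d))
    (y : 'rV[R]_n) (i : 'I_n) : Prop :=
  exists2 alpha, unique (dual_optimal X y) alpha & 0 < alpha i ord0.

(* Main.v *)
Require Import Defs.
From HB Require Import structures.
From mathcomp Require Import all_boot all_order all_algebra.
From mathcomp Require Import all_classical all_reals all_analysis.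
From mathcomp Require Import measurable_realfun ring lra.

Set Implicit Arguments.
Unset Strict Implicit.
Unset Printing Implicit Defensive.
Import Order.TTheory GRing.Theory Num.Theory.
Import numFieldNormedType.Exports.
Local Open Scope classical_set_scope.
Local Open Scope ring_scope.

(* Put [D = diag(lambda)^(1/2)] and [tau = |lambda|_1]. If the least eigenvalue of
   the Gram matrix is at least [tau / 64] and if, for every [i], the minimum norm
   interpolator [w_i] of the labels other than [y_i] satisfies [|<w_i, x_i>| < 1],
   then the unconstrained dual optimum has positive coordinates, so every example
   is a support vector.

   Only left invariance of the Haar measure is used, and only through averages
   over finitely many rotations: for a sign vector [eps] a Householder reflection
   sends a given unit vector to [eps] normalised, so the probability of an event
   is the average over [U] of its proportion among the [2^d] reflected matrices.
   - For [v] in [R^n], the form [|v^T X|^2 / |v|^2] becomes [|eps^T U D|^2], a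
     positive quadratic form in independent signs with mean [tau] and norm at
     most [|lambda|_oo]. Both of its tails are of order [exp (- c d_oo)] by
     Maurey's infimum convolution inequality for convex functions on the cube,
     applied to the form itself. A union bound over the lattice points of mesh
     [1 / (32 sqrt n)] in the unit ball then controls the least eigenvalue.
   - Rotating row [i] together with the [d - n] unused rows of [U] leaves [w_i]
     and the law of the other labels unchanged, and turns [<w_i, x_i>] into a
     linear form in signs of variance at most
     [(d / (d - n + 1)) |lambda|_oo |w_i|^2], where [|w_i|^2 <= 64 n / tau]. *)

(** * The discrete cube *)

Section Cube.
Variable R : realType.
Implicit Types (n : nat).

Lemma expR_geDsqr (x : R) : 0 <= x -> 1 + x + x ^+ 2 / 2 <= expR x.
Proof.
move=> x0; have -> : 1 + x + x ^+ 2 / 2 = series (exp_coeff x) 3.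
  rewrite /series /= !big_nat_recr //= big_nil /exp_coeff /= !factS fact0.
  by rewrite expr0 expr1 !mul1n muln1 !divr1 add0r.
apply: nondecreasing_cvgn_le; last exact: is_cvg_series_exp_coeff.
by apply: nondecreasing_series => n _ _; exact: exp_coeff_ge0.
Qed.

Definition fcons n (a : R) (x : 'I_n -> R) : 'I_n.+1 -> R :=
  fun i => if unlift ord0 i is Some j then x j else a.

(** The arguments are real vectors rather than boolean ones, so that convex functions on all of
    [R^n] can be averaged over the cube. *)
Definition cube_avg n (F : ('I_n -> R) -> R) : R :=
  2^-1 ^+ n * \sum_(e : {ffun 'I_n -> bool}) F (fun i => (-1) ^+ e i).

Lemma fcons0 n a (x : 'I_n -> R) : fcons a x ord0 = a.
Proof. by rewrite /fcons unlift_none. Qed.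

Lemma fconsS n a (x : 'I_n -> R) j : fcons a x (lift ord0 j) = x j.
Proof. by rewrite /fcons liftK. Qed.

Lemma cube_avg0 (F : ('I_0 -> R) -> R) x : cube_avg F = F x.
Proof.
rewrite /cube_avg expr0 mul1r (big_pred1 [ffun=> true]) => [|e].
  by congr F; apply/funext; case.
by rewrite /= eq_sym; apply/esym/eqP/ffunP; case.
Qed.

Lemma cube_avgS n (F : ('I_n.+1 -> R) -> R) :
  cube_avg F = 2^-1 * (cube_avg (F \o fcons 1) + cube_avg (F \o fcons (-1))).
Proof.
rewrite /cube_avg exprS -mulrDr -mulrA; congr (_ * (_ * _)).
pose h (p : bool * {ffun 'I_n -> bool}) : {ffun 'I_n.+1 -> bool} :=
  [ffun i => if unlift ord0 i is Some j then p.2 j else p.1].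
pose h' (e : {ffun 'I_n.+1 -> bool}) : bool * {ffun 'I_n -> bool} :=
  (e ord0, [ffun j => e (lift ord0 j)]).
rewrite (reindex h) /=; last first.
  exists h' => [[b e] _|e _] /=.
    congr (_, _); first by rewrite ffunE unlift_none.
    by apply/ffunP => j; rewrite !ffunE liftK.
  apply/ffunP => i; rewrite ffunE.
  by case: unliftP => [j|] -> //=; rewrite ffunE.
rewrite -(pair_bigA _ (fun b e => F (fun i => (-1) ^+ h (b, e) i))) /=.
rewrite big_bool /= addrC; congr (_ + _); apply: eq_bigr => e _; congr F;
  apply/funext => i; rewrite /fcons /h ffunE; case: unliftP => [j|] _ //=.
Qed.

Lemma cube_avg_sum n (F : ('I_n -> R) -> R) :
  2 ^+ n * cube_avg F =
  \sum_(e : {ffun 'I_n -> bool}) F (fun i => (-1) ^+ e i).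
Proof.
by rewrite /cube_avg (@mulrA R) -(@exprMn R) divff ?pnatr_eq0// expr1n mul1r.
Qed.

Lemma eq_cube_avg n (F G : ('I_n -> R) -> R) : F =1 G -> cube_avg F = cube_avg G.
Proof. by move=> /funext ->. Qed.

Lemma cube_avgD n (F G : ('I_n -> R) -> R) :
  cube_avg (fun x => F x + G x) = cube_avg F + cube_avg G.
Proof. by rewrite /cube_avg big_split mulrDr. Qed.

Lemma cube_avgZ n a (F : ('I_n -> R) -> R) :
  cube_avg (fun x => a * F x) = a * cube_avg F.
Proof. by rewrite /cube_avg -mulr_sumr mulrCA. Qed.

Lemma cube_avg_cst n a : cube_avg (fun _ : 'I_n -> R => a) = a.
Proof.
rewrite /cube_avg sumr_const card_ffun card_bool card_ord -[a *+ _]mulr_natl.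
by rewrite mulrA natrX -exprMn mulVf ?pnatr_eq0// expr1n mul1r.
Qed.

Lemma ler_cube_avg n (F G : ('I_n -> R) -> R) :
  (forall x, (forall i, x i ^+ 2 = 1) -> F x <= G x) ->
  cube_avg F <= cube_avg G.
Proof.
move=> FG; rewrite /cube_avg; apply: ler_wpM2l; first exact: exprn_ge0.
by apply: ler_sum => e _; apply: FG => i; rewrite sqrr_sign.
Qed.

Lemma cube_avg_ge0 n (F : ('I_n -> R) -> R) :
  (forall x, 0 <= F x) -> 0 <= cube_avg F.
Proof. by move=> F0; rewrite -(cube_avg_cst n 0); apply: ler_cube_avg. Qed.

Lemma cube_avg_bigsum n (I : finType) (F : I -> ('I_n -> R) -> R) :
  cube_avg (fun x => \sum_i F i x) = \sum_i cube_avg (F i).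
Proof. by rewrite /cube_avg exchange_big mulr_sumr. Qed.

Lemma cube_avg_coord1 n (i : 'I_n) : cube_avg (fun x => x i) = 0.
Proof.
elim: n i => [[]//|n IH i]; rewrite cube_avgS.
case: (unliftP ord0 i) => [i'|] ->.
  by rewrite !(@eq_cube_avg _ (_ \o _) (fun x => x i')) ?IH ?addr0 ?mulr0 // => x;
    rewrite /= fconsS.
rewrite (@eq_cube_avg _ _ (fun=> 1)) => [|x]; last by rewrite /= fcons0.
rewrite (@eq_cube_avg _ (_ \o fcons (-1)) (fun=> -1)) => [|x]; last by rewrite /= fcons0.
by rewrite !cube_avg_cst subrr mulr0.
Qed.

Lemma cube_avg_coord n (j k : 'I_n) :
  cube_avg (fun x => x j * x k) = (j == k)%:R.
Proof.
elim: n j k => [[]//|n IH j k].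
rewrite cube_avgS.
case: (unliftP ord0 j) => [j'|] ->; case: (unliftP ord0 k) => [k'|] ->;
  rewrite /comp.
- rewrite (@eq_cube_avg _ _ (fun x => x j' * x k')); last first.
    by move=> x; rewrite !fconsS.
  rewrite (@eq_cube_avg _ (fun _ => fcons (-1) _ _ * _) (fun x => x j' * x k')); last first.
    by move=> x; rewrite !fconsS.
  rewrite IH (inj_eq (@lift_inj _ _)); lra.
- rewrite (@eq_cube_avg _ _ (fun x => x j')); last first.
    by move=> x; rewrite fcons0 fconsS mulr1.
  rewrite (@eq_cube_avg _ (fun _ => fcons (-1) _ _ * _) (fun x => -1 * x j')); last first.
    by move=> x; rewrite fcons0 fconsS mulrC.
  by rewrite cube_avgZ cube_avg_coord1 mulr0 addr0 mulr0.
- rewrite (@eq_cube_avg _ _ (fun x => x k')); last first.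
    by move=> x; rewrite fcons0 fconsS mul1r.
  rewrite (@eq_cube_avg _ (fun _ => fcons (-1) _ _ * _) (fun x => -1 * x k')); last first.
    by move=> x; rewrite fcons0 fconsS.
  by rewrite cube_avgZ cube_avg_coord1 mulr0 addr0 mulr0.
- rewrite (@eq_cube_avg _ _ (fun x => 1)); last first.
    by move=> x; rewrite fcons0 mulr1.
  rewrite (@eq_cube_avg _ (fun _ => fcons (-1) _ _ * _) (fun x => 1)); last first.
    by move=> x; rewrite fcons0 mulrNN mulr1.
  by rewrite !cube_avg_cst eqxx /= mulr1n; lra.
Qed.

(** Average the tangent line of [expR] at the mean [m]. *)
Lemma cube_avg_jensen n (F : ('I_n -> R) -> R) :
  expR (cube_avg F) <= cube_avg (expR \o F).
Proof.
set m := cube_avg F.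
have -> : expR m = cube_avg (fun x => expR m * (1 + (F x - m))).
  by rewrite cube_avgZ !cube_avgD !cube_avg_cst subrr addr0 mulr1.
apply: ler_cube_avg => x _ /=.
have -> : expR (F x) = expR m * expR (F x - m) by rewrite -expRD subrKC.
by rewrite ler_pM2l ?expR_gt0// expR_ge1Dx.
Qed.

End Cube.

(** * Infimum convolution on the cube *)

Section InfConv.
Variable R : realType.

(** Bounding [expR (y / 2)] by the inverse of [1 - y / 2], where [y] is the exponent, leaves a
    polynomial inequality. This closes [two_point_infconv], where [x = 1 - t]. *)
Lemma expR_pade (x : R) : 0 <= x <= 1 -> expR (x - 3 / 8 * x ^+ 2) * (2 - x) <= 2 + x.
Proof.
move=> /andP[x0 x1]; set y := x - _.
have y2 : 0 < 1 - y / 2 by rewrite /y; nra.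
have e1 : expR y * (1 - y / 2) ^+ 2 <= 1.
  have -> : expR y = expR (y / 2) ^+ 2 by rewrite expr2 -expRD; congr expR; lra.
  have h : expR (y / 2) * (1 - y / 2) <= 1.
    rewrite -[leRHS](expRxMexpNx_1 (y / 2)) ler_pM2l ?expR_gt0//.
    exact: expR_ge1Dx.
  rewrite -exprMn exprn_ile1//.
  by rewrite mulr_ge0 ?expR_ge0// ltW.
have e2 : 2 - x <= (2 + x) * (1 - y / 2) ^+ 2.
  rewrite -subr_ge0 (_ : _ - _ = x ^+ 2 * (1 / 4 + x / 4 +
    x ^+ 2 * (9 / 128 - 3 / 16) + 9 / 256 * x ^+ 3)); last by rewrite /y; field.
  by apply: mulr_ge0; nra.
have e0 := expR_ge0 y.
have := ler_wpM2l e0 e2; rewrite mulrCA => /le_trans; apply.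
by rewrite ler_piMr//; lra.
Qed.

(* With [t = exp (b - a)] the choice [s = 1 - t] is nearly optimal. *)
Lemma two_point_infconv (a b : R) : b <= a ->
  exists2 s, 0 <= s <= 1 &
  (expR ((1 - s) * a + s * b + s ^+ 2 / 8) + expR b) * (expR (- a) + expR (- b)) <= 4.
Proof.
move=> ba; pose dl := a - b; pose t := expR (- dl).
have dl0 : 0 <= dl by rewrite /dl subr_ge0.
have t0 : 0 < t by exact: expR_gt0.
have t1 : t <= 1 by rewrite -expR0 ler_expR oppr_le0.
exists (1 - t); first lra.
(* Divided by [t], this is [dl <= sinh dl]. It follows from [y <= expR dl], because [z^2 - 2 dl z]
   increases for [z >= dl]. *)
have tdl : t * dl <= (1 - t ^+ 2) / 2.
  have E := expR_geDsqr dl0; set y := 1 + dl + dl ^+ 2 / 2 in E.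
  have y1 : 1 <= y by rewrite /y; have := sqr_ge0 dl; lra.
  have tE : t * expR dl = 1 by rewrite /t mulrC expRxMexpNx_1.
  have ey : 2 * dl * expR dl <= expR dl ^+ 2 - 1.
    have h : 2 * dl * y <= y ^+ 2 - 1.
      rewrite -subr_ge0 (_ : _ - _ = (dl ^+ 2) ^+ 2 / 4) ?divr_ge0 ?sqr_ge0//.
      by rewrite /y; field.
    have dly : 2 * dl <= y + expR dl.
      by rewrite /y in E *; have := sqr_ge0 dl; have := sqr_ge0 (dl - 1); lra.
    have : 0 <= (expR dl - y) * (expR dl + y - 2 * dl).
      by apply: mulr_ge0; lra.
    by lra.
  have -> : t * dl = t ^+ 2 * (dl * expR dl) by rewrite expr2 -mulrA (mulrCA t dl) tE mulr1.
  have -> : (1 - t ^+ 2) / 2 = t ^+ 2 * ((expR dl ^+ 2 - 1) / 2).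
    by rewrite mulrA mulrBr mulr1 -exprMn tE expr1n.
  apply: ler_wpM2l; first exact: sqr_ge0.
  lra.
pose x := 1 - t.
have x01 : 0 <= x <= 1 by rewrite /x; lra.
have key := expR_pade x01.
(* Here [(1 - t^2) / 2 = x - x^2 / 2], and adding [x^2 / 8] gives the exponent of [expR_pade]. *)
have le1 : expR (t * dl + x ^+ 2 / 8) <= expR (x - 3 / 8 * x ^+ 2).
  rewrite ler_expR; move: tdl; rewrite /x; nra.
have -> : (1 - (1 - t)) * a + (1 - t) * b + (1 - t) ^+ 2 / 8 = b + (t * dl + x ^+ 2 / 8).
  by rewrite /x /dl; ring.
have -> : - a = - b - dl by rewrite /dl; ring.
set u := expR (t * dl + _) in le1.
rewrite expRD -/u [expR (- b - dl)]expRD -/t.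
have eb : expR b * expR (- b) = 1 by exact: expRxMexpNx_1.
have -> : (expR b * u + expR b) * (expR (- b) * t + expR (- b)) =
  expR b * expR (- b) * ((u + 1) * (1 + t)) by ring.
rewrite eb mul1r.
have {}key : u * (2 - x) <= 2 + x.
  by apply: le_trans key; rewrite ler_wpM2r// /x; lra.
by move: key; rewrite /x; lra.
Qed.

Lemma expR_conv (s x y : R) : 0 <= s <= 1 ->
  expR ((1 - s) * x + s * y) <= (1 - s) * expR x + s * expR y.
Proof.
move=> /andP[s0 s1]; set m := _ + s * y.
have ht z : expR m * (1 + (z - m)) <= expR z.
  have -> : expR z = expR m * expR (z - m) by rewrite -expRD subrKC.
  by rewrite ler_pM2l ?expR_gt0// expR_ge1Dx.
have hy := ler_wpM2l s0 (ht y).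
have s1' : 0 <= 1 - s by lra.
have hx := ler_wpM2l s1' (ht x).
apply: le_trans (lerD hx hy).
have : expR m * ((1 - s) * x + s * y - m) = 0 by rewrite subrr mulr0.
by clearbody m; lra.
Qed.

Definition conv_fun n (f : ('I_n -> R) -> R) := forall x y s, 0 <= s <= 1 ->
  f (fun i => (1 - s) * x i + s * y i) <= (1 - s) * f x + s * f y.

Definition sqdist n (x y : 'I_n -> R) : R := \sum_i (x i - y i) ^+ 2.

Lemma sqdist_fcons n a b (x y : 'I_n -> R) :
  sqdist (fcons a x) (fcons b y) = (a - b) ^+ 2 + sqdist x y.
Proof.
rewrite /sqdist big_ord_recl !fcons0; congr (_ + _).
by apply: eq_bigr => i _; rewrite !fconsS.
Qed.

Lemma sqdist_conv n (z x y : 'I_n -> R) s : 0 <= s <= 1 ->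
  sqdist z (fun i => (1 - s) * x i + s * y i) <=
  (1 - s) * sqdist z x + s * sqdist z y.
Proof.
move=> /andP[s0 s1]; rewrite /sqdist !mulr_sumr -big_split; apply: ler_sum => i _ /=.
have : 0 <= s * (1 - s) * (x i - y i) ^+ 2.
  by apply: mulr_ge0 (sqr_ge0 _); apply: mulr_ge0; lra.
nra.
Qed.

Lemma fcons_conv n a b (x y : 'I_n -> R) s :
  fcons ((1 - s) * a + s * b) (fun i => (1 - s) * x i + s * y i) =
  (fun i => (1 - s) * fcons a x i + s * fcons b y i).
Proof. by apply/funext => i; rewrite /fcons; case: unlift. Qed.

(** The cost is scaled so that moving by a fraction [s] of an edge of the cube, which has length 2,
    costs [s^2 / 8], as in [two_point_infconv]. *)
Definition infconv n (f : ('I_n -> R) -> R) (x : 'I_n -> R) : R :=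
  inf (range (fun y => f y + sqdist x y / 32)).

Section Slice.
Variables (n : nat) (f g : ('I_n.+1 -> R) -> R).
Hypothesis gf : forall x y, g x <= f y + sqdist x y / 32.

(** Finiteness of the infimum comes from the minorant [g]. *)
Let lbs a (x : 'I_n -> R) :
  has_inf (range (fun y => f (fcons a y) + sqdist x y / 32)).
Proof.
split; first by exists (f (fcons a x) + sqdist x x / 32); exists x.
exists (g (fcons a x)) => _ [y _ <-].
by rewrite (le_trans (gf _ (fcons a y)))// sqdist_fcons subrr expr0n add0r.
Qed.

Lemma infconv_slice_le a x y :
  infconv (f \o fcons a) x <= f (fcons a y) + sqdist x y / 32.
Proof. by apply: (ge_inf (lbs a x).2); exists y. Qed.

Lemma slice_le_infconv a x : g (fcons a x) <= infconv (f \o fcons a) x.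
Proof.
apply: lb_le_inf (lbs a x).1 _ => _ [y _ <-].
by rewrite (le_trans (gf _ (fcons a y)))// sqdist_fcons subrr expr0n add0r.
Qed.

(** Near-minimisers over the faces [a] and [b] are combined with weights [1 - s] and [s]. Convexity
    of [f] and of the squared distance bounds the value there; the first coordinate alone adds
    [s^2 (a - b)^2 / 32]. *)
Lemma slice_le_infconv_conv a b x s : conv_fun f -> 0 <= s <= 1 ->
  g (fcons a x) <= (1 - s) * infconv (f \o fcons a) x +
     s * infconv (f \o fcons b) x + s ^+ 2 * (a - b) ^+ 2 / 32.
Proof.
move=> cf s01; apply/ler_addgt0Pr => e e0.
have [_ [y1 _ <-] y1e] := inf_adherent e0 (lbs a x).
have [_ [y2 _ <-] y2e] := inf_adherent e0 (lbs b x).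
apply: (le_trans (gf _ (fcons ((1 - s) * a + s * b) (fun i => (1 - s) * y1 i + s * y2 i)))).
have := sqdist_conv x y1 y2 s01.
rewrite sqdist_fcons fcons_conv.
have := cf (fcons a y1) (fcons b y2) s s01.
have -> : (a - ((1 - s) * a + s * b)) ^+ 2 = s ^+ 2 * (a - b) ^+ 2 by ring.
move/andP: s01 => [s0 s1].
have s1' : 0 <= 1 - s by lra.
have := ler_wpM2l s1' (ltW y1e); have := ler_wpM2l s0 (ltW y2e).
rewrite -!/(infconv _ _); lra.
Qed.

End Slice.

(* Maurey's property (tau) of the uniform measure on the cube, restricted to
   convex functions. *)
Theorem cube_infconv n (f g : ('I_n -> R) -> R) : conv_fun f ->
  (forall x y, g x <= f y + sqdist x y / 32) ->
  cube_avg (expR \o g) * cube_avg (fun x => expR (- f x)) <= 1.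
Proof.
elim: n f g => [|n IH] f g cf gf.
  pose x0 : 'I_0 -> R := fun=> 0.
  rewrite !(cube_avg0 _ x0) /= -expRD -expR0 ler_expR subr_le0.
  by rewrite (le_trans (gf x0 x0))// /sqdist big_ord0 mul0r addr0.
pose psi a := cube_avg (fun x => expR (- f (fcons a x))).
have psi0 a : 0 < psi a.
  rewrite /psi /cube_avg mulr_gt0 ?exprn_gt0 ?invr_gt0//.
  rewrite (bigD1 [ffun=> true])//= ltr_pwDl ?expR_gt0//.
  by apply: sumr_ge0 => *; exact: expR_ge0.
have slice a : cube_avg (expR \o infconv (f \o fcons a)) * psi a <= 1.
  apply: IH => [x y s s01|x y] /=.
    have -> : fcons a (fun i => (1 - s) * x i + s * y i) =
        (fun i => (1 - s) * fcons a x i + s * fcons a y i).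
      by rewrite -fcons_conv; congr fcons; ring.
    exact: cf.
  exact: (infconv_slice_le gf).
pose al a := - ln (psi a).
have psiE a : psi a = expR (- al a) by rewrite /al opprK lnK ?posrE.
have sliceE a : cube_avg (expR \o infconv (f \o fcons a)) <= expR (al a).
  by rewrite -(ler_pM2r (psi0 a)) {2}psiE expRxMexpNx_1.
(* The two faces are interchangeable, so [a] can be the one with the smaller [psi], hence the larger
   [al], as [two_point_infconv] requires. *)
suff main a b : (a - b) ^+ 2 = 4 -> psi a <= psi b ->
    (cube_avg (expR \o g \o fcons a) + cube_avg (expR \o g \o fcons b)) *
    (psi a + psi b) <= 4.
  rewrite !cube_avgS -/(psi 1) -/(psi (-1)).
  suff : (cube_avg (expR \o g \o fcons 1) + cube_avg (expR \o g \o fcons (-1))) *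
      (psi 1 + psi (-1)) <= 4 by lra.
  have [le|/ltW le] := leP (psi 1) (psi (-1)); first by apply: main => //; ring.
  by rewrite addrC [psi 1 + _]addrC; apply: main => //; ring.
move=> ab psi_le.
have [|s s01 key] := @two_point_infconv (al a) (al b).
  by rewrite lerN2 ler_ln ?posrE.
have gb : cube_avg (expR \o g \o fcons b) <= expR (al b).
  apply: le_trans (sliceE b); apply: ler_cube_avg => x _ /=.
  by rewrite ler_expR (slice_le_infconv gf).
(* On the face [a] the minimiser may move the fraction [s] of the way to [b]. Convexity of [expR],
   applied to the exponents [G - al a] and [H - al b], reduces the mean to the two slice bounds. *)
have ga : cube_avg (expR \o g \o fcons a) <=
    expR ((1 - s) * al a + s * al b + s ^+ 2 / 8).
  set G := infconv (f \o fcons a); set H := infconv (f \o fcons b).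
  set B := _ + s * _ + _.
  apply: (@le_trans _ _ (cube_avg (fun x => expR B *
    ((1 - s) * (expR (- al a) * expR (G x)) +
     s * (expR (- al b) * expR (H x)))))).
    apply: ler_cube_avg => x _ /=; rewrite -!expRD.
    apply: (@le_trans _ _ (expR (B + ((1 - s) * (- al a + G x) + s * (- al b + H x))))).
      rewrite ler_expR (le_trans (slice_le_infconv_conv gf a b x cf s01))//.
      by rewrite ab /B -/G -/H; lra.
    by rewrite [leLHS]expRD ler_pM2l ?expR_gt0// expR_conv.
  rewrite cube_avgZ ler_piMr ?expR_ge0// cube_avgD !cube_avgZ -!psiE.
  have := slice a; have := slice b; rewrite -/G -/H /comp.
  move/andP: s01 => [s0 s1] h1 h2.
  have s1' : 0 <= 1 - s by lra.
  have := ler_wpM2l s1' h2; have := ler_wpM2l s0 h1; lra.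
rewrite !psiE; apply: le_trans key.
by rewrite ler_wpM2r ?addr_ge0 ?expR_ge0// lerD.
Qed.

End InfConv.

(** * Concentration of linear and quadratic forms in signs *)

Section CubeTails.
Variable R : realType.

(** The infimum convolution of the linear form [f] is exactly [f - 8 |a|^2], attained at
    [y = x - 16 a]. The factor with [- f] is at least 1 by Jensen, since [f] has mean zero. *)
Lemma cube_linear_mgf n (a : 'I_n -> R) :
  cube_avg (fun x => expR (\sum_i a i * x i)) <= expR (8 * \sum_i a i ^+ 2).
Proof.
pose f (x : 'I_n -> R) := \sum_i a i * x i.
pose g x := f x - 8 * \sum_i a i ^+ 2.
have cf : conv_fun f.
  move=> x y s _; rewrite /f !mulr_sumr -big_split /= le_eqVlt; apply/orP; left.
  by apply/eqP/eq_bigr => i _; ring.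
have gf x y : g x <= f y + sqdist x y / 32.
  rewrite /g /f /sqdist lerBlDr mulr_sumr mulr_suml -!big_split /=.
  apply: ler_sum => i _; have := sqr_ge0 (16 * a i - (x i - y i)); lra.
have := cube_infconv cf gf.
rewrite (@eq_cube_avg _ _ (expR \o g)
  (fun x => expR (- (8 * \sum_i a i ^+ 2)) * expR (f x))); last first.
  by move=> x; rewrite /= /g addrC expRD.
rewrite cube_avgZ => key.
have f1 : 1 <= cube_avg (fun x => expR (- f x)).
  apply: le_trans (cube_avg_jensen (fun x => - f x)).
  rewrite (@eq_cube_avg _ _ (fun x => - f x) (fun x => \sum_i - a i * x i)); last first.
    by move=> x; rewrite -sumrN; apply: eq_bigr => i _; rewrite mulNr.
  rewrite cube_avg_bigsum big1 ?expR0// => i _.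
  by rewrite cube_avgZ cube_avg_coord1 mulr0.
set A := cube_avg _ in key *.
have A0 : 0 <= A by apply: cube_avg_ge0 => x; exact: expR_ge0.
set v := 8 * _ in key *.
have : expR (- v) * A <= 1.
  by apply: le_trans key; rewrite ler_peMr// mulr_ge0 ?expR_ge0.
by rewrite -(ler_pM2l (expR_gt0 v)) mulrA expRxMexpNx_1 mul1r mulr1.
Qed.

(** A Chernoff bound. The threshold [D] may be negative and [V] measures the variance relative to
    [D ^+ 2], because [D] will be the determinant appearing in [loo_bad]. *)
Lemma cube_linear_tail n (a : 'I_n -> R) (D V : R) : D != 0 -> 0 < V ->
  \sum_i a i ^+ 2 <= V * D ^+ 2 ->
  cube_avg (fun x => (`|D| <= `|\sum_i a i * x i|)%R%:R) <= 2 * expR (- (32 * V)^-1).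
Proof.
(* This [t] minimises [- t + 8 V t^2]; the minimum is [- t / 2]. *)
move=> D0 V0 aV; pose t := (16 * V)^-1; pose u := t / `|D|.
have t0 : 0 < t by rewrite invr_gt0; lra.
have nD : 0 < `|D| by rewrite normr_gt0.
have mgf b : b ^+ 2 = u ^+ 2 ->
    cube_avg (fun x => expR (b * \sum_i a i * x i)) <= expR (t / 2).
  move=> bu; rewrite (@eq_cube_avg _ _ _ (fun x => expR (\sum_i (b * a i) * x i))); last first.
    by move=> x; rewrite mulr_sumr; congr expR; apply: eq_bigr => i _; rewrite mulrA.
  apply: le_trans (cube_linear_mgf _) _; rewrite ler_expR.
  under eq_bigr do rewrite exprMn.
  rewrite -mulr_sumr bu.
  apply: (@le_trans _ _ (8 * (u ^+ 2 * (V * D ^+ 2)))).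
    by rewrite ler_pM2l// ler_wpM2l// sqr_ge0.
  have -> : u ^+ 2 * (V * D ^+ 2) = t ^+ 2 * V.
    rewrite /u -[D ^+ 2]real_normK ?num_real//; field.
    by rewrite gt_eqF.
  have -> : t ^+ 2 * V = t / 16 by rewrite /t; field; rewrite gt_eqF.
  lra.
have -> : - (32 * V)^-1 = - t + t / 2 by rewrite /t; field; rewrite gt_eqF.
apply: (@le_trans _ _ (expR (- t) * (expR (t / 2) + expR (t / 2)))); last first.
  by rewrite expRD; lra.
apply: (@le_trans _ _ (cube_avg (fun x => expR (- t) * (expR (u * \sum_i a i * x i) +
    expR (- u * \sum_i a i * x i))))); last first.
  by rewrite cube_avgZ ler_pM2l ?expR_gt0// cube_avgD lerD// mgf// sqrrN.
apply: ler_cube_avg => x _; set L := \sum_i _.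
have e1 := expR_gt0 (u * L); have e2 := expR_gt0 (- u * L).
case: (leP `|D| `|L|) => [le|_]; last first.
  by rewrite mulr_ge0 ?expR_ge0// addr_ge0// ltW.
rewrite mulr1n -(expRxMexpNx_1 (- t)) opprK ler_pM2l ?expR_gt0//.
have tu : t <= u * `|L|.
  by rewrite /u mulrAC -mulrA ler_peMr ?ler_pdivlMr ?mul1r// ltW.
have [L0|L0] := leP 0 L; [rewrite ger0_norm// in tu|rewrite ltr0_norm// in tu].
  by apply: le_trans (_ : expR (u * L) <= _); [rewrite ler_expR|lra].
apply: le_trans (_ : expR (- u * L) <= _); last lra.
by rewrite ler_expR mulNr -mulrN.
Qed.

Section Quadratic.
Variables (n p : nat) (B : 'I_n -> 'I_p -> R) (L : R).
Let q (x : 'I_n -> R) := \sum_k (\sum_j x j * B j k) ^+ 2.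
Let tr := \sum_j \sum_k B j k ^+ 2.
Hypothesis L0 : 0 < L.
Hypothesis qL : forall x, q x <= L * \sum_i x i ^+ 2.

Lemma cube_quad_mean : cube_avg q = tr.
Proof.
rewrite /q cube_avg_bigsum /tr exchange_big /=; apply: eq_bigr => k _.
rewrite (@eq_cube_avg _ _ _ (fun x => \sum_i \sum_j B i k * B j k * (x i * x j))); last first.
  move=> x; rewrite expr2 mulr_suml; apply: eq_bigr => i _.
  by rewrite mulr_sumr; apply: eq_bigr => j _; ring.
rewrite cube_avg_bigsum; apply: eq_bigr => i _.
rewrite cube_avg_bigsum (bigD1 i)//= big1 ?addr0 => [|j ji].
  by rewrite cube_avgZ cube_avg_coord eqxx mulr1 expr2.
by rewrite cube_avgZ cube_avg_coord eq_sym (negbTE ji) mulr0.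
Qed.

Let conv_q c : 0 <= c -> conv_fun (fun x => c * q x).
Proof.
move=> c0 x y s /andP[s0 s1].
rewrite !(mulrCA _ c) -mulrDr ler_wpM2l// /q !mulr_sumr -big_split /=.
apply: ler_sum => k _.
have -> : \sum_j ((1 - s) * x j + s * y j) * B j k =
    (1 - s) * (\sum_j x j * B j k) + s * (\sum_j y j * B j k).
  by rewrite !mulr_sumr -big_split; apply: eq_bigr => j _ /=; ring.
set a := \sum_j x j * _; set b := \sum_j y j * _.
have : 0 <= s * (1 - s) * (a - b) ^+ 2.
  by apply: mulr_ge0 (sqr_ge0 _); apply: mulr_ge0; lra.
lra.
Qed.

Let q_split x y : q x <= 2 * q y + 2 * L * sqdist x y.
Proof.
apply: (@le_trans _ _ (2 * q y + 2 * q (fun i => x i - y i))); last first.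
  by have := qL (fun i => x i - y i); rewrite /sqdist; lra.
rewrite /q !mulr_sumr -big_split; apply: ler_sum => k _ /=.
have -> : \sum_j (x j - y j) * B j k = \sum_j x j * B j k - \sum_j y j * B j k.
  by rewrite -sumrB; apply: eq_bigr => j _; ring.
set a := \sum_j x j * _; set b := \sum_j y j * _.
have := sqr_ge0 (a - 2 * b); lra.
Qed.

(** Divided by [64 * L], the splitting [q_split] has exactly the cost [sqdist x y / 32]. Each tail
    below applies Markov to one factor and bounds the other from below by Jensen. *)
Let key : cube_avg (fun x => expR (q x / (64 * L))) *
  cube_avg (fun x => expR (- (q x / (32 * L)))) <= 1.
Proof.
have := @cube_infconv R n (fun x => (32 * L)^-1 * q x) (fun x => q x / (64 * L)).
rewrite (@eq_cube_avg _ _ (fun x => expR (- ((32 * L)^-1 * q x)))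
  (fun x => expR (- (q x / (32 * L))))); last first.
  by move=> x; rewrite mulrC.
apply; first by apply: conv_q; rewrite invr_ge0 ltW ?mulr_gt0.
move=> x y; rewrite ler_pdivrMr ?mulr_gt0//.
have -> : ((32 * L)^-1 * q y + sqdist x y / 32) * (64 * L) = 2 * q y + 2 * L * sqdist x y.
  by field; rewrite gt_eqF.
exact: q_split.
Qed.

(** The exponential moment of [- q / (32 L)] is at most [expR (- tr / (64 L))]; Markov at the level
    [tr / 4] gives back half of that exponent. *)
Lemma cube_quad_lower :
  cube_avg (fun x => (q x < tr / 4)%R%:R) <= expR (- (tr / L / 128)).
Proof.
apply: (@le_trans _ _ (cube_avg (fun x => expR (tr / L / 128) * expR (- (q x / (32 * L)))))).
  apply: ler_cube_avg => x _; case: ltP => [lt|_]; last by rewrite mulr_ge0 ?expR_ge0.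
  rewrite -expRD -[leLHS]expR0 ler_expR subr_ge0 ler_pdivrMr ?mulr_gt0//.
  have -> : tr / L / 128 * (32 * L) = tr / 4 by field; rewrite gt_eqF.
  exact: ltW.
rewrite cube_avgZ.
have -> : - (tr / L / 128) = tr / L / 128 - tr / L / 64 by lra.
rewrite expRD ler_pM2l ?expR_gt0//.
have J := cube_avg_jensen (fun x => q x / (64 * L)).
rewrite (@eq_cube_avg _ _ (fun x => q x / (64 * L))
  (fun x => (64 * L)^-1 * q x)) in J; last first.
  by move=> x; rewrite mulrC.
rewrite cube_avgZ cube_quad_mean in J.
have E : (64 * L)^-1 * tr = tr / L / 64 by field; rewrite gt_eqF.
rewrite E in J.
set A := cube_avg _ in J; set A' := cube_avg _.
have A'0 : 0 <= A' by apply: cube_avg_ge0 => x; exact: expR_ge0.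
rewrite -(ler_pM2l (expR_gt0 (tr / L / 64))) expRxMexpNx_1.
by apply: le_trans key; rewrite ler_wpM2r.
Qed.

(** The exponential moment of [q / (64 L)] is at most [expR (tr / (32 L))], while Markov at the
    level [4 * tr] gains [tr / (16 L)]. *)
Lemma cube_quad_upper :
  cube_avg (fun x => (4 * tr < q x)%R%:R) <= expR (- (tr / L / 32)).
Proof.
apply: (@le_trans _ _ (cube_avg (fun x => expR (- (tr / L / 16)) * expR (q x / (64 * L))))).
  apply: ler_cube_avg => x _; case: ltP => [lt|_]; last by rewrite mulr_ge0 ?expR_ge0.
  rewrite -expRD -[leLHS]expR0 ler_expR addrC subr_ge0 ler_pdivlMr ?mulr_gt0//.
  have -> : tr / L / 16 * (64 * L) = 4 * tr by field; rewrite gt_eqF.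
  exact: ltW.
rewrite cube_avgZ.
have -> : - (tr / L / 32) = - (tr / L / 16) + tr / L / 32 by lra.
rewrite expRD ler_pM2l ?expR_gt0//.
have J := cube_avg_jensen (fun x => - (q x / (32 * L))).
rewrite (@eq_cube_avg _ _ (fun x => - (q x / (32 * L)))
  (fun x => - (32 * L)^-1 * q x)) in J; last first.
  by move=> x; rewrite mulNr mulrC.
rewrite cube_avgZ cube_quad_mean in J.
have E : - (32 * L)^-1 * tr = - (tr / L / 32) by field; rewrite gt_eqF.
rewrite E in J.
set A := cube_avg _.
have A0 : 0 <= A by apply: cube_avg_ge0 => x; exact: expR_ge0.
rewrite -(ler_pM2r (expR_gt0 (- (tr / L / 32)))) expRxMexpNx_1.
by apply: le_trans key; rewrite ler_wpM2l.
Qed.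

End Quadratic.
End CubeTails.
(** * A net of the unit ball *)

Section Net.
Variable R : realType.

Definition sqn n (v : 'I_n -> R) : R := \sum_i v i ^+ 2.

Definition qform n d (A : 'M[R]_(n, d)) (v : 'I_n -> R) : R :=
  \sum_k (\sum_j v j * A j k) ^+ 2.

Local Notation net_index n := {ffun 'I_n -> 'I_(32 * n).+1 * bool}.

Definition net n : {pred net_index n} :=
  [pred k : net_index n | (\sum_i (k i).1 <= 32 * n)%N].

(* The points of the lattice of mesh [1 / (32 sqrt n)]; those with index in [net]
   include every vector of the unit ball rounded towards zero. *)
Definition net_vec n (k : net_index n) (i : 'I_n) : R :=
  (-1) ^+ (k i).2 * ((k i).1%:R / (32 * Num.sqrt n%:R)).

(** The weight [W] is at least 1 on the net, and its sum over all indices factors over the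
    coordinates. Each coordinate contributes at most [2 * (1 + 1/2 + 1/4 + ...) = 4], whence
    [2 ^ (32 n) * 4 ^ n]. *)
Lemma card_net n : (#|@net n|%:R : R) <= 2 ^+ (34 * n).
Proof.
have pow2 a b : (a <= b)%N -> 1 <= 2 ^+ b * 2^-1 ^+ a :> R.
  move=> /subnK <-; rewrite exprD -mulrA -exprMn divff ?pnatr_eq0//.
  by rewrite expr1n mulr1 exprn_ege1// ler1n.
rewrite -sum1_card natr_sum.
pose W (k : net_index n) : R :=
  2 ^+ (32 * n) * \prod_i 2^-1 ^+ (k i).1.
have W0 k : 0 <= W k by rewrite mulr_ge0 ?exprn_ge0// prodr_ge0// => i _; rewrite exprn_ge0.
apply: (@le_trans _ _ (\sum_k W k)).
  rewrite [leRHS](bigID (mem (@net n)))/= ler_wpDr ?sumr_ge0//.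
  apply: ler_sum => k; rewrite inE => kn.
  by rewrite /W prodrXr pow2.
rewrite -mulr_sumr -(bigA_distr_bigA (fun _ (j : 'I_(32 * n).+1 * bool) => (2^-1 : R) ^+ j.1)).
rewrite (_ : 34 * n = 32 * n + 2 * n)%N; last by rewrite -mulnDl.
rewrite exprD ler_pM2l ?exprn_gt0//.
rewrite [in leRHS]exprM -[X in _ ^+ X](card_ord n) -prodr_const.
apply: ler_prod => i _; apply/andP; split; first by apply: sumr_ge0 => j _; rewrite exprn_ge0.
rewrite -(pair_bigA _ (fun (j : 'I_(32 * n).+1) (b : bool) => (2^-1 : R) ^+ j)) /=.
under eq_bigr do rewrite big_bool /=.
have -> m : \sum_(j < m) (2^-1 ^+ j + 2^-1 ^+ j : R) = 4 - 4 * 2^-1 ^+ m.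
  elim: m => [|m IH]; first by rewrite big_ord0 expr0; lra.
  by rewrite big_ord_recr /= IH exprS; lra.
have : 0 <= (2^-1 : R) ^+ (32 * n).+1 by rewrite exprn_ge0.
by rewrite expr2; lra.
Qed.

Lemma sqn_ge0 n (v : 'I_n -> R) : 0 <= sqn v.
Proof. by apply: sumr_ge0 => i _; exact: sqr_ge0. Qed.

(** Rounding towards zero does not increase the norm, and errs by at most [1 / (32 sqrt n)] in each
    of the [n] coordinates. *)
Lemma net_approx n (v : 'I_n -> R) : (0 < n)%N -> sqn v <= 1 ->
  exists2 k, k \in @net n &
    sqn (net_vec k) <= 1 /\ sqn (fun i => v i - net_vec k i) <= 1 / 1024.
Proof.
move=> n0 v1; pose s := Num.sqrt (n%:R : R).
have nR0 : 0 < (n%:R : R) by rewrite ltr0n.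
have s0 : 0 < s by rewrite sqrtr_gt0.
have ss : s ^+ 2 = n%:R by rewrite sqr_sqrtr ?ler0n.
pose m i := Num.truncn (`|v i| * (32 * s)).
have mle i : (m i)%:R <= `|v i| * (32 * s).
  by rewrite truncn_le mulr_ge0// mulr_ge0// ltW.
have mgt i : `|v i| * (32 * s) < (m i)%:R + 1.
  by rewrite natr1; exact: truncnS_gt.
have summ : (\sum_i m i <= 32 * n)%N.
  rewrite -(ler_nat R) natr_sum natrM.
  (* This is [2 s |v i| <= 1 + s^2 (v i)^2]; the sum is at most [16 (n + n)]. *)
  apply: (@le_trans _ _ (\sum_i (16 * (1 + n%:R * v i ^+ 2)))).
    apply: ler_sum => i _; apply: le_trans (mle i) _.
    rewrite -ss -[v i ^+ 2](real_normK (num_real _)).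
    by have := sqr_ge0 (s * `|v i| - 1); lra.
  rewrite -mulr_sumr big_split /= -mulr_sumr sumr_const card_ord.
  have := ler_wpM2l (ltW nR0) v1; rewrite /sqn; lra.
have mb i : (m i < (32 * n).+1)%N.
  by rewrite ltnS (leq_trans _ summ)// (bigD1 i)//= leq_addr.
pose k : net_index n := [ffun i => (Ordinal (mb i), v i < 0)].
have wE i : net_vec k i = (-1) ^+ (v i < 0)%R * ((m i)%:R / (32 * s)).
  by rewrite /net_vec ffunE.
have s32 : 0 < 32 * s by rewrite mulr_gt0.
have vE i : v i = (-1) ^+ (v i < 0)%R * `|v i|.
  by rewrite mulrC [LHS]numEsign mulrC mulr_sign.
have wle i : 0 <= (m i)%:R / (32 * s) <= `|v i|.
  by rewrite ler_pdivrMr// mle andbT divr_ge0// ltW.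
exists k; first by rewrite inE; under eq_bigr do rewrite ffunE.
split.
  apply: le_trans v1; apply: ler_sum => i _; rewrite wE exprMn sqrr_sign mul1r.
  rewrite -[v i ^+ 2](real_normK (num_real _)).
  by rewrite lerXn2r ?nnegrE//; case/andP: (wle i).
apply: (@le_trans _ _ (\sum_(i < n) (32 * s) ^- 2)).
  apply: ler_sum => i _; rewrite wE {1}vE -mulrBr exprMn sqrr_sign mul1r -exprVn.
  case/andP: (wle i) => _ wi.
  have inv0 : 0 <= (32 * s)^-1 by rewrite invr_ge0 ltW.
  rewrite lerXn2r ?nnegrE ?subr_ge0// lerBlDr -[X in X + _]mul1r -mulrDl.
  by rewrite ler_pdivlMr// addrC ltW.
rewrite sumr_const card_ord -[_ *+ n]mulr_natl -ss exprMn le_eqVlt; apply/orP; left.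
by apply/eqP; field; rewrite gt_eqF.
Qed.

Lemma qform_ge0 n d (A : 'M[R]_(n, d)) v : 0 <= qform A v.
Proof. by apply: sumr_ge0 => i _; exact: sqr_ge0. Qed.

Lemma qformZ n d (A : 'M[R]_(n, d)) c v :
  qform A (fun i => c * v i) = c ^+ 2 * qform A v.
Proof.
rewrite /qform mulr_sumr; apply: eq_bigr => k _; rewrite -exprMn mulr_sumr.
by congr (_ ^+ 2); apply: eq_bigr => i _; rewrite mulrA.
Qed.

Lemma sqnZ n c (v : 'I_n -> R) : sqn (fun i => c * v i) = c ^+ 2 * sqn v.
Proof. by rewrite /sqn mulr_sumr; apply: eq_bigr => i _; rewrite exprMn. Qed.

Lemma qform_split n d (A : 'M[R]_(n, d)) v w :
  qform A v <= 2 * qform A w + 2 * qform A (fun i => v i - w i).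
Proof.
rewrite /qform !mulr_sumr -big_split; apply: ler_sum => k _ /=.
have -> : \sum_j (v j - w j) * A j k = \sum_j v j * A j k - \sum_j w j * A j k.
  by rewrite -sumrB; apply: eq_bigr => j _; ring.
set a := \sum_j v j * _; set b := \sum_j w j * _.
have := sqr_ge0 (a - 2 * b); lra.
Qed.

Lemma qform_bounded n d (A : 'M[R]_(n, d)) :
  exists M, forall v, sqn v <= 1 -> qform A v <= M.
Proof.
exists (\sum_k (\sum_j `|A j k|) ^+ 2) => v v1; apply: ler_sum => k _.
rewrite -[leLHS](real_normK (num_real _)).
rewrite lerXn2r ?nnegrE ?sumr_ge0// (le_trans (ler_norm_sum _ _ _))//.
apply: ler_sum => j _; rewrite normrM ler_piMl//.
rewrite -(@expr_le1 _ 2)// real_normK ?num_real//.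
apply: le_trans v1; rewrite /sqn (bigD1 j)//= ler_wpDr// sumr_ge0// => i _.
exact: sqr_ge0.
Qed.

Definition net_good n d (t : R) (A : 'M[R]_(n, d)) := forall k, k \in @net n ->
  t / 4 * sqn (net_vec k) <= qform A (net_vec k) <= 4 * t * sqn (net_vec k).

(** The supremum [M] of the form over the unit ball satisfies [M <= 8 t + M / 512], hence
    [M <= 16 t]. The rounding error of a unit vector therefore contributes at most [t / 64] to the
    form, too little to cancel the lower bound [t / 16] at its net point. *)
Lemma net_good_lower n d t (A : 'M[R]_(n, d)) : (0 < n)%N -> 0 <= t -> net_good t A ->
  forall v, t / 64 * sqn v <= qform A v.
Proof.
move=> n0 t0 good.
have [M0 M0P] := qform_bounded A.
pose S := [set qform A v | v in [set v | sqn v <= 1]].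
have z1 : sqn (fun _ : 'I_n => 0 : R) <= 1.
  by rewrite /sqn big1 ?ler01// => i _; rewrite expr0n.
have SS : has_sup S.
  split; first by exists (qform A (fun=> 0)); exists (fun=> 0).
  by exists M0 => _ [v /= v1 <-]; exact: M0P.
pose M := sup S.
have MP v : sqn v <= 1 -> qform A v <= M.
  by move=> v1; apply: sup_upper_bound => //; exists v.
have small v : sqn v <= 1 / 1024 -> qform A v <= M / 1024.
  move=> v1; have /MP : sqn (fun i => 32 * v i) <= 1 by rewrite sqnZ; lra.
  by rewrite qformZ; lra.
have M16 : M <= 16 * t.
  suff : M <= 8 * t + M / 512 by lra.
  apply: ge_sup SS.1 _ => _ [v /= v1 <-].
  have [k kn [w1 wv]] := net_approx n0 v1.
  have /andP[_ up] := good k kn.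
  have := small _ wv; have := qform_split A v (net_vec k).
  have : 4 * t * sqn (net_vec k) <= 4 * t by rewrite ler_piMr// mulr_ge0.
  lra.
have unit v : sqn v = 1 -> t / 64 <= qform A v.
  move=> v1; have [|k kn [w1 wv]] := net_approx n0 (v := v); first by rewrite v1.
  have /andP[lo _] := good k kn.
  have := small _ wv.
  have := qform_split A (net_vec k) v.
  have -> : qform A (fun i => net_vec k i - v i) = qform A (fun i => v i - net_vec k i).
    have := qformZ A (-1) (fun i => v i - net_vec k i).
    rewrite sqrrN expr1n mul1r => <-; congr qform.
    by apply/funext => i; ring.
  (* The rounded vector keeps a fixed share of the norm, so the bound at the net point, which is
     relative to its norm, is not vacuous. *)
  have wlo : 1 / 4 <= sqn (net_vec k).
    suff : sqn v <= 2 * sqn (net_vec k) + 2 * sqn (fun i => v i - net_vec k i) by lra.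
    rewrite /sqn !mulr_sumr -big_split; apply: ler_sum => i _ /=.
    have := sqr_ge0 (v i - 2 * net_vec k i); lra.
  have : t / 4 * (1 / 4 * 2) <= t / 4 * sqn (net_vec k) + t / 16.
    have := ler_wpM2l (_ : 0 <= t / 4) wlo; rewrite divr_ge0// => /(_ isT); lra.
  lra.
move=> v; have [v0|v0] := eqVneq (sqn v) 0; first by rewrite v0 mulr0 qform_ge0.
have vp : 0 < sqn v by rewrite lt_def v0 sqn_ge0.
pose c := (Num.sqrt (sqn v))^-1.
have cc : c ^+ 2 * sqn v = 1 by rewrite /c exprVn sqr_sqrtr ?mulVf// ltW.
have := unit (fun i => c * v i); rewrite sqnZ qformZ => /(_ cc).
move=> /(ler_wpM2r (ltW vp)); rewrite [leRHS]mulrAC cc mul1r; lra.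
Qed.

End Net.
(** * Support vectors *)

Section SupportVectors.
Variable R : realType.

Definition dot n (u v : 'rV[R]_n) : R := (u *m v^T) 0 0.

Lemma dotE n (u v : 'rV[R]_n) : dot u v = \sum_i u 0 i * v 0 i.
Proof. by rewrite /dot mxE; apply: eq_bigr => i _; rewrite mxE. Qed.

Lemma dotC n (u v : 'rV[R]_n) : dot u v = dot v u.
Proof. by rewrite !dotE; apply: eq_bigr => i _; rewrite mulrC. Qed.

Lemma dotDl n (u v w : 'rV[R]_n) : dot (u + v) w = dot u w + dot v w.
Proof. by rewrite /dot mulmxDl mxE. Qed.

Lemma dotZl n a (u w : 'rV[R]_n) : dot (a *: u) w = a * dot u w.
Proof. by rewrite /dot -scalemxAl mxE. Qed.

Lemma dotDr n (u v w : 'rV[R]_n) : dot w (u + v) = dot w u + dot w v.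
Proof. by rewrite dotC dotDl !(dotC w). Qed.

Lemma dotZr n a (u w : 'rV[R]_n) : dot w (a *: u) = a * dot w u.
Proof. by rewrite dotC dotZl dotC. Qed.

Lemma dot_mulmx n d (u : 'rV[R]_n) (A : 'M[R]_(n, d)) v :
  dot (u *m A) v = dot u (v *m A^T).
Proof. by rewrite /dot trmx_mul trmxK mulmxA. Qed.

Lemma dot_ge0 n (u : 'rV[R]_n) : 0 <= dot u u.
Proof. by rewrite dotE sumr_ge0// => i _; rewrite -expr2 sqr_ge0. Qed.

Lemma dot_eq0 n (u : 'rV[R]_n) : dot u u = 0 -> u = 0.
Proof.
rewrite dotE => /psumr_eq0P u0; apply/rowP => i; rewrite mxE.
apply/eqP; rewrite -sqrf_eq0 expr2 u0// => j _; by rewrite -expr2 sqr_ge0.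
Qed.

Lemma dot_delta n (u : 'rV[R]_n) i : dot u (delta_mx 0 i) = u 0 i.
Proof.
rewrite dotE (bigD1 i)//= big1 => [|j ji].
  by rewrite addr0 mxE !eqxx mulr1.
by rewrite mxE (negbTE ji) andbF mulr0.
Qed.

Lemma dot_sqn n (u : 'rV[R]_n) : dot u u = sqn (fun i => u 0 i).
Proof. by rewrite dotE; apply: eq_bigr => i _; rewrite expr2. Qed.

Lemma dot_qform n d (u : 'rV[R]_n) (A : 'M[R]_(n, d)) :
  dot (u *m A) (u *m A) = qform A (fun i => u 0 i).
Proof. by rewrite dotE; apply: eq_bigr => i _; rewrite -expr2 mxE. Qed.

Lemma gram_mul n d (u : 'rV[R]_n) (A : 'M[R]_(n, d)) :
  u *m gram_mx A = u *m A *m A^T.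
Proof. by rewrite /gram_mx mulmxA. Qed.

Lemma dual_objectiveE n d (A : 'M[R]_(n, d)) y al :
  let u := al^T *m diag_mx y in
  dual_objective A y al = \sum_i al i 0 - 2^-1 * dot (u *m A) (u *m A).
Proof.
rewrite /= /dual_objective /dot /gram_mx !trmx_mul tr_diag_mx trmxK !mulmxA.
by [].
Qed.

Lemma detV_mul n (M : 'M[R]_n) (v : 'rV_n) : \det M != 0 ->
  ((\det M)^-1 *: (v *m \adj M)) *m M = v.
Proof.
by move=> M0; rewrite -scalemxAl -mulmxA mul_adj_mx mul_mx_scalar scalerA mulVf ?scale1r.
Qed.

Lemma det_neq0 n (M : 'M[R]_n) : (forall u : 'rV_n, u *m M = 0 -> u = 0) -> \det M != 0.
Proof.
move=> h; rewrite -unitfE -unitmxE -row_free_unit -kermx_eq0.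
apply/eqP/row_matrixP => i; rewrite row0; apply: h.
by rewrite -row_mul mulmx_ker row0.
Qed.

Lemma det_inj n (M : 'M[R]_n) (u : 'rV_n) : \det M != 0 -> u *m M = 0 -> u = 0.
Proof.
move=> M0 uM; rewrite -(mulmxK (_ : M \in unitmx) u) ?uM ?mul0mx//.
by rewrite unitmxE unitfE.
Qed.

(** As [\adj K = \det K * K^-1], the product is [y_i (K^-1 y)_i] times the square of the
    determinant: the unconstrained dual optimum has positive coordinates. This form is polynomial in
    the entries, hence measurable. *)
Definition all_sv n d (A : 'M[R]_(n, d)) (y : 'rV[R]_n) : Prop :=
  \det (gram_mx A) != 0 /\
  forall i, 0 < y 0 i * (y *m \adj (gram_mx A)) 0 i * \det (gram_mx A).

Section Characterization.
Variables (n d : nat) (A : 'M[R]_(n, d)) (y : 'rV[R]_n).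
Hypothesis y2 : forall i, y 0 i ^+ 2 = 1.
Let K := gram_mx A.
Let obj := dual_objective A y.

Let sgnmul (al : 'cV[R]_n) : 'rV_n := al^T *m diag_mx y.

Let sgnmulE al i : sgnmul al 0 i = al i 0 * y 0 i.
Proof.
rewrite /sgnmul mxE (bigD1 i)//= big1 => [|j ji]; first by rewrite !mxE eqxx mulr1n addr0.
by rewrite !mxE (negbTE ji) mulr0n mulr0.
Qed.

Let sgnmul_inj al : sgnmul al = 0 -> al = 0.
Proof.
move=> /rowP h; apply/colP => i; have := h i; rewrite sgnmulE !mxE.
by move=> e; rewrite -[LHS]mulr1 -(y2 i) expr2 mulrA e mul0r.
Qed.

(** The objective is quadratic, so this second-order expansion is exact; the sum multiplying [t] is
    the derivative in the direction [h]. *)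
Let obj_expand (al h : 'cV[R]_n) t : obj (al + t *: h) =
  obj al + t * (\sum_i h i 0 * (1 - y 0 i * (sgnmul al *m K) 0 i)) -
  t ^+ 2 / 2 * dot (sgnmul h *m A) (sgnmul h *m A).
Proof.
rewrite /obj !dual_objectiveE -!/(sgnmul _).
have -> : sgnmul (al + t *: h) = sgnmul al + t *: sgnmul h.
  by rewrite /sgnmul linearD linearZ /= mulmxDl -scalemxAl.
rewrite mulmxDl -scalemxAl !dotDl !dotDr !dotZl !dotZr.
have -> : \sum_i (al + t *: h) i 0 = \sum_i al i 0 + t * \sum_i h i 0.
  by rewrite mulr_sumr -big_split; apply: eq_bigr => i _; rewrite !mxE.
have -> : \sum_i h i 0 * (1 - y 0 i * (sgnmul al *m K) 0 i) =
    \sum_i h i 0 - dot (sgnmul al *m A) (sgnmul h *m A).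
  rewrite [X in _ - X]dotC dot_mulmx -gram_mul dotE -sumrB; apply: eq_bigr => i _.
  by rewrite sgnmulE mulrBr mulr1 mulrA.
rewrite (dotC (sgnmul h *m A) (sgnmul al *m A)); lra.
Qed.

(** At the stationary point [al] the expansion has no linear term, so [al] is the strict global
    maximum, and it is feasible since its coordinates are positive. *)
Lemma all_sv_support i : all_sv A y -> support_vector A y i.
Proof.
move=> [K0 pos].
pose b := (\det K)^-1 *: (y *m \adj K).
pose al : 'cV[R]_n := \col_j (y 0 j * b 0 j).
have alb : sgnmul al = b.
  by apply/rowP => j; rewrite sgnmulE mxE mulrAC -expr2 y2 mul1r.
have bK : b *m K = y by exact: detV_mul.
have al0 j : 0 < al j 0.
  rewrite mxE [b 0 j]mxE.
  have -> : y 0 j * ((\det K)^-1 * (y *m \adj K) 0 j) =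
      (\det K) ^- 2 * (y 0 j * (y *m \adj K) 0 j * \det K) by field.
  by rewrite mulr_gt0// invr_gt0 lt_def sqrf_eq0 K0 sqr_ge0.
have expand be : obj be = obj al -
    2^-1 * dot (sgnmul (be - al) *m A) (sgnmul (be - al) *m A).
  rewrite -{1}(subrKC al be) -[be - al in LHS]scale1r obj_expand expr1n mul1r alb bK.
  by rewrite big1 ?mulr0 ?addr0 ?div1r// => j _; rewrite -expr2 y2 subrr mulr0.
have opt be : obj be <= obj al.
  by rewrite expand gerBl mulr_ge0 ?dot_ge0// invr_ge0.
exists al => //; split.
  by split=> [j|be _]; [exact: ltW|exact: opt].
move=> be [beF beO].
have eq : obj be = obj al.
  by apply/eqP; rewrite eq_le opt /=; apply: beO => j; exact: ltW.
have : dot (sgnmul (be - al) *m A) (sgnmul (be - al) *m A) = 0.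
  by have := expand be; rewrite eq; lra.
move/dot_eq0 => z; apply/esym/eqP; rewrite -subr_eq0; apply/eqP.
apply: sgnmul_inj; apply: (@det_inj _ K) => //.
by rewrite gram_mul z mul0mx.
Qed.

(** This converse makes the event measurable. The optimum is interior, so the gradient vanishes
    there; a kernel vector of [K] would yield a second optimum, contradicting uniqueness. *)
Lemma support_all_sv : (0 < n)%N -> (forall i, support_vector A y i) -> all_sv A y.
Proof.
move=> n0 sv; have [al alU _] := sv (Ordinal n0).
have {sv}al0 i : 0 < al i 0.
  by have [al' al'U] := sv i; rewrite -(alU.2 _ al'U.1).
have [[_ opt] uniq] := alU.
have feas (h : 'cV[R]_n) : exists2 e : R, 0 < e &
    forall t, `|t| <= e -> dual_feasible (al + t *: h).
  have [e e0 he] : exists2 e : R, 0 < e & forall i, e * `|h i 0| <= al i 0.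
    pose m := \big[Num.min/1]_i al i 0.
    have m0 : 0 < m by rewrite /m; elim/big_ind: _ => // a b a0 b0; rewrite lt_min a0.
    have mi i : m <= al i 0 by rewrite /m (bigD1 i)//= ge_min lexx.
    pose s := 1 + \sum_i `|h i 0|.
    have s1 : 1 <= s by rewrite lerDl sumr_ge0.
    have hs i : `|h i 0| <= s.
      by rewrite /s (bigD1 i)//= addrCA ler_wpDr// addr_ge0// sumr_ge0.
    have sp : 0 < s by lra.
    exists (m / s) => [|i]; first by rewrite divr_gt0.
    rewrite (le_trans _ (mi i))// mulrAC ler_pdivrMr// ler_wpM2l//; exact: ltW.
  exists e => // t te i; rewrite !mxE.
  have : `|t * h i 0| <= al i 0.
    by rewrite normrM (le_trans _ (he i))// ler_wpM2r.
  by rewrite ler_norml => /andP[+ _]; lra.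
have grad (h : 'cV[R]_n) : \sum_i h i 0 * (1 - y 0 i * (sgnmul al *m K) 0 i) = 0.
  set G := \sum_i _; set Q := dot (sgnmul h *m A) (sgnmul h *m A).
  have [e e0 he] := feas h.
  have Q0 : 0 <= Q by exact: dot_ge0.
  have step t : `|t| <= e -> t * G <= t ^+ 2 / 2 * Q.
    by move=> /he /opt; rewrite -/obj obj_expand -/G -/Q; lra.
  apply/eqP/negPn/negP => G0.
  have G2 : 0 < G ^+ 2 by rewrite lt_def sqrf_eq0 G0 sqr_ge0.
  (* The first bound keeps the step [t * G] feasible. By the second, the quadratic loss is at most
     half of the gain [t * G ^+ 2]. *)
  pose t := Num.min (e / `|G|) (1 / (1 + Q)).
  have nG : 0 < `|G| by rewrite normr_gt0.
  have Q1 : 0 < 1 + Q by lra.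
  have t0 : 0 < t by rewrite lt_min !divr_gt0.
  have te : `|t * G| <= e.
    by rewrite normrM (gtr0_norm t0) -ler_pdivlMr// ge_min lexx.
  have tQ : t * (1 + Q) <= 1 by rewrite -ler_pdivlMr// ge_min lexx orbT.
  have := step _ te.
  have -> : t * G * G = t * G ^+ 2 by ring.
  have -> : (t * G) ^+ 2 / 2 * Q = t * G ^+ 2 * (t * Q / 2) by ring.
  have tG : 0 < t * G ^+ 2 by rewrite mulr_gt0.
  rewrite -[leLHS]mulr1 ler_pM2l//; lra.
have alK : sgnmul al *m K = y.
  apply/rowP => i; have := grad (delta_mx i 0).
  rewrite (bigD1 i)//= big1 => [|j ji]; last by rewrite mxE (negbTE ji) mul0r.
  rewrite mxE !eqxx mul1r addr0 => e.
  have : y 0 i * (1 - y 0 i * (sgnmul al *m K) 0 i) = 0 by rewrite e mulr0.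
  by rewrite mulrBr mulr1 mulrA -expr2 y2 mul1r; lra.
have K0 : \det K != 0.
  apply: det_neq0 => u uK; pose h : 'cV[R]_n := \col_j (y 0 j * u 0 j).
  have hu : sgnmul h = u.
    by apply/rowP => j; rewrite sgnmulE mxE mulrAC -expr2 y2 mul1r.
  have uA : u *m A = 0 by apply: dot_eq0; rewrite dot_mulmx -gram_mul uK /dot trmx0 mulmx0 mxE.
  have [e e0 he] := feas h.
  have same : obj (al + e *: h) = obj al.
    by rewrite obj_expand grad hu uA /dot mul0mx mxE !mulr0 addr0 subr0.
  have /uniq : dual_optimal A y (al + e *: h).
    split; first by apply: he; rewrite ger0_norm// ltW.
    by move=> be beF; rewrite -/obj same; exact: opt.
  move=> /eqP; rewrite -subr_eq0 opprD addrA subrr add0r oppr_eq0 scaler_eq0.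
  by rewrite gt_eqF//= => /eqP h0; rewrite -hu h0 /sgnmul trmx0 mul0mx.
have yK i : (y *m \adj K) 0 i = \det K * sgnmul al 0 i.
  by rewrite -{1}alK -mulmxA mul_mx_adj mul_mx_scalar mxE.
split=> // i; rewrite -/K yK sgnmulE.
have -> : y 0 i * (\det K * (al i 0 * y 0 i)) * \det K =
    al i 0 * y 0 i ^+ 2 * \det K ^+ 2 by ring.
by rewrite y2 mulr1 mulr_gt0// lt_def sqrf_eq0 K0 sqr_ge0.
Qed.

Lemma support_vectorP : (0 < n)%N ->
  (forall i, support_vector A y i) <-> all_sv A y.
Proof.
by move=> n0; split; [exact: support_all_sv|move=> h i; exact: all_sv_support].
Qed.

End Characterization.
End SupportVectors.

(** * Leave-one-out interpolators *)

Section LeaveOneOut.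
Variable R : realType.

Definition zero_row n d (i : 'I_n) (A : 'M[R]_(n, d)) : 'M[R]_(n, d) :=
  \matrix_(j, k) (if j == i then 0 else A j k).

Definition zero_col n (i : 'I_n) (y : 'rV[R]_n) : 'rV[R]_n :=
  \row_j (if j == i then 0 else y 0 j).

(* The Gram matrix of the examples other than [i], padded with a 1 at [(i, i)]. *)
Definition loo_gram n d (i : 'I_n) (A : 'M[R]_(n, d)) : 'M[R]_n :=
  gram_mx (zero_row i A) + delta_mx i i.

(* [loo_vec / \det (loo_gram)] is the minimum norm interpolator of the labels of
   the examples other than [i]; clearing the denominator keeps [loo_bad]
   polynomial in the entries of [A], hence measurable. *)
Definition loo_vec n d (i : 'I_n) (y : 'rV[R]_n) (A : 'M[R]_(n, d)) : 'rV[R]_d :=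
  zero_col i y *m \adj (loo_gram i A) *m zero_row i A.

(** After division by the determinant, the interpolator has squared norm at most [V] and inner
    product at least 1 in modulus with example [i]. The norm bound belongs to the event because it
    controls the variance in the tail estimate. *)
Definition loo_bad n d (V : R) (i : 'I_n) (y : 'rV[R]_n) (A : 'M[R]_(n, d)) : Prop :=
  [/\ \det (loo_gram i A) != 0,
      dot (loo_vec i y A) (loo_vec i y A) <= V * \det (loo_gram i A) ^+ 2 &
      `|\det (loo_gram i A)| <= `|dot (loo_vec i y A) (row i A)| ].

Section Good.
Variables (n d : nat) (A : 'M[R]_(n, d)) (y : 'rV[R]_n) (c : R).
Hypothesis y2 : forall i, y 0 i ^+ 2 = 1.
Hypothesis c0 : 0 < c.
Hypothesis Ac : forall v, c * sqn v <= qform A v.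

Let Ac' (u : 'rV[R]_n) : c * dot u u <= dot (u *m A) (u *m A).
Proof. by rewrite dot_sqn dot_qform; exact: Ac. Qed.

Let K0 : \det (gram_mx A) != 0.
Proof.
apply: det_neq0 => u uK; apply: dot_eq0; apply/eqP; rewrite eq_le dot_ge0 andbT.
rewrite -(pmulr_rle0 _ c0) (le_trans (Ac' u))// dot_mulmx -gram_mul uK.
by rewrite /dot trmx0 mulmx0 mxE.
Qed.

Let mul_zero_row (u : 'rV[R]_n) i : u *m zero_row i A = zero_col i u *m A.
Proof.
apply/rowP => k; rewrite !mxE; apply: eq_bigr => j _; rewrite !mxE.
by case: ifP => _; rewrite ?mulr0 ?mul0r.
Qed.

Let mul_loo (u : 'rV[R]_n) i :
  u *m loo_gram i A = u *m zero_row i A *m (zero_row i A)^T + u 0 i *: delta_mx 0 i.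
Proof.
rewrite /loo_gram mulmxDr gram_mul; congr (_ + _); apply/rowP => j.
rewrite !mxE eqxx (bigD1 i)//= big1 => [|k ki].
  by rewrite mxE eqxx addr0.
by rewrite mxE (negbTE ki) mulr0.
Qed.

Let loo_det i : \det (loo_gram i A) != 0.
Proof.
apply: det_neq0 => u uM.
have : dot u (u *m loo_gram i A) = 0 by rewrite uM /dot trmx0 mulmx0 mxE.
rewrite mul_loo dotDr -dot_mulmx dotZr dot_delta mul_zero_row -expr2 => e.
have h1 := dot_ge0 (zero_col i u *m A); have h2 := sqr_ge0 (u 0 i).
have ui : u 0 i = 0 by apply/eqP; rewrite -sqrf_eq0; apply/eqP; lra.
have zu : zero_col i u = u.
  by apply/rowP => j; rewrite mxE; case: eqP => [->|].
apply: dot_eq0; apply/eqP; rewrite eq_le dot_ge0 andbT -(pmulr_rle0 _ c0).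
by rewrite zu in e h1; rewrite (le_trans (Ac' u))//; lra.
Qed.

Let rowB (u v : 'rV[R]_n) j : (u - v) 0 j = u 0 j - v 0 j.
Proof. by rewrite !mxE. Qed.

(** Let [b = y K^-1], and let [g] be the coefficients of the interpolator. Then [(b - g) K] is [t]
    times the [i]-th unit vector, with [t = y_i - <w_i, x_i>]. Pairing with [b - g] gives
    [t b_i > 0], while [y_i t > 0] because [|<w_i, x_i>| < 1]; hence [y_i b_i > 0]. *)
Lemma not_loo_bad_all_sv : (forall i, ~ loo_bad (n%:R / c) i y A) -> all_sv A y.
Proof.
move=> ok; split=> // i.
pose D := \det (loo_gram i A).
pose g := D^-1 *: (zero_col i y *m \adj (loo_gram i A)).
have gM : g *m loo_gram i A = zero_col i y by exact: detV_mul (loo_det i).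
(* Column [i] of [gM] reads [g_i = 0], thanks to the padding of [loo_gram]. *)
have gi : g 0 i = 0.
  have := gM; rewrite mul_loo => /rowP /(_ i); rewrite !mxE !eqxx mulr1.
  by rewrite big1 ?add0r// => k _; rewrite !mxE eqxx mulr0.
have zg : zero_col i g = g.
  by apply/rowP => j; rewrite mxE; case: eqP => [->|].
have gA : g *m zero_row i A = g *m A by rewrite mul_zero_row zg.
have gK j : j != i -> (g *m gram_mx A) 0 j = y 0 j.
  move=> ji; have := gM; rewrite mul_loo gi scale0r addr0 gA => /rowP /(_ j).
  rewrite mxE [in RHS]mxE (negbTE ji) => <-; rewrite gram_mul mxE.
  by apply: eq_bigr => k _; rewrite !mxE (negbTE ji).
have gAE : g *m A = D^-1 *: loo_vec i y A by rewrite -gA /g -scalemxAl.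
clearbody g.
have gAn : dot (g *m A) (g *m A) = dot g (zero_col i y).
  by rewrite -gM mul_loo gi scale0r addr0 -dot_mulmx gA.
have yn : dot (zero_col i y) (zero_col i y) <= n%:R.
  rewrite dotE -[leRHS]mulr1 mulr_natl -[X in _ *+ X](card_ord n) -sumr_const.
  apply: ler_sum => j _; rewrite mxE -expr2; case: ifP => _; last by rewrite y2.
  by rewrite expr0n ler01.
(* With [G] the squared norm, expanding [|c g - y|^2 >= 0], where [y] has its [i]-th label zeroed,
   gives [2 c G <= c^2 |g|^2 + n], and [c |g|^2 <= G]. *)
have wn : dot (g *m A) (g *m A) <= n%:R / c.
  set G := dot (g *m A) _ in gAn *.
  have h1 : c * dot g g <= G by exact: Ac'.
  have h2 : 2 * c * G <= c ^+ 2 * dot g g + n%:R.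
    have := dot_ge0 (c *: g - zero_col i y).
    rewrite dotDl !dotDr !dotZl !dotZr -scaleN1r !dotZl !dotZr.
    by rewrite (dotC _ g) -gAn; move: yn; lra.
  rewrite ler_pdivlMr//.
  have := ler_wpM2l (ltW c0) h1; lra.
have D2 : 0 < D ^+ 2 by rewrite lt_def sqrf_eq0 loo_det sqr_ge0.
have lt1 : `|dot (g *m A) (row i A)| < 1.
  rewrite ltNge; apply/negP => ge1; apply: (ok i); split; first exact: loo_det.
    have := wn; rewrite gAE dotZl dotZr -/D => /(ler_wpM2r (ltW D2)).
    rewrite (_ : _ * _ * _ = dot (loo_vec i y A) (loo_vec i y A))//.
    by field; exact: loo_det.
  move: ge1; rewrite gAE dotZl normrM normfV -/D ler_pdivlMl ?mulr1//.
  by rewrite normr_gt0 loo_det.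
pose K := gram_mx A.
pose b := (\det K)^-1 *: (y *m \adj K).
have bK : b *m K = y by exact: detV_mul.
pose t := y 0 i - dot (g *m A) (row i A).
have gKi : (g *m K) 0 i = dot (g *m A) (row i A).
  by rewrite gram_mul dotE mxE; apply: eq_bigr => k _; rewrite !mxE.
have bgK : (b - g) *m K = t *: delta_mx 0 i.
  rewrite mulmxBl bK; apply/rowP => j; rewrite rowB [RHS]mxE [in RHS]mxE.
  have [->|ji] := eqVneq j i; first by rewrite !eqxx mulr1 gKi.
  by rewrite (gK _ ji) subrr andbF mulr0.
have yt : 0 < y 0 i * t.
  rewrite /t mulrBr -expr2 y2 subr_gt0.
  apply: le_lt_trans lt1; apply: le_trans (ler_norm _) _.
  have /eqP : `|y 0 i| ^+ 2 = 1 by rewrite real_normK ?num_real.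
  by rewrite normrM sqrp_eq1// => /eqP ->; rewrite mul1r.
have tb : dot ((b - g) *m A) ((b - g) *m A) = t * b 0 i.
  by rewrite dot_mulmx -gram_mul bgK dotZr dot_delta rowB gi subr0.
have tb0 : 0 < t * b 0 i.
  rewrite -tb; apply: lt_le_trans (Ac' _); rewrite mulr_gt0// lt_def dot_ge0 andbT.
  apply/eqP => /dot_eq0 bg0; move: bgK; rewrite bg0 mul0mx => /rowP /(_ i).
  by rewrite !mxE !eqxx mulr1 => t0; move: yt; rewrite -t0 mulr0 ltxx.
have bE : b 0 i = (\det K)^-1 * (y *m \adj K) 0 i by rewrite mxE.
have t2 : 0 < t ^+ 2.
  by rewrite lt_def sqr_ge0 andbT sqrf_eq0; apply/eqP => t0; move: yt; rewrite t0 mulr0 ltxx.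
rewrite -(pmulr_rgt0 _ t2).
have -> : t ^+ 2 * (y 0 i * (y *m \adj K) 0 i * \det K) =
    \det K ^+ 2 * ((y 0 i * t) * (t * b 0 i)).
  by rewrite bE; field; exact: K0.
by apply: mulr_gt0 (mulr_gt0 yt tb0); rewrite lt_def sqrf_eq0 K0 sqr_ge0.
Qed.

End Good.
End LeaveOneOut.

(** * Householder reflections *)

Section Householder.
Variable R : realType.

(* The reflection exchanging two vectors of the same norm; when [a = b] the
   division by zero makes it the identity. *)
Definition householder d (a b : 'rV[R]_d) : 'M[R]_d :=
  1%:M - (2 / dot (b - a) (b - a)) *: ((b - a)^T *m (b - a)).

Lemma dot_mul_tr d (v : 'rV[R]_d) : v *m v^T = (dot v v)%:M.
Proof. by rewrite [LHS]mx11_scalar. Qed.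

Lemma householder_orth d (a b : 'rV[R]_d) : orthogonal_mx (householder a b).
Proof.
rewrite /orthogonal_mx /= /householder; move: (b - a) => v; set s := 2 / _.
have [v0|v0] := eqVneq (dot v v) 0.
  by rewrite /s v0 invr0 mulr0 scale0r subr0 trmx1 mulmx1.
have -> : (1%:M - s *: (v^T *m v))^T = 1%:M - s *: (v^T *m v).
  by apply/matrixP => i j; rewrite !mxE !big_ord1 !mxE eq_sym (mulrC (v 0 j)).
rewrite mulmxBl mul1mx mulmxBr mulmx1 -scalemxAl -scalemxAr.
have -> : v^T *m v *m (v^T *m v) = dot v v *: (v^T *m v).
  by rewrite -mulmxA (mulmxA v) dot_mul_tr mul_scalar_mx scalemxAr.
apply/matrixP => i j; rewrite !mxE /s; field; exact: v0.
Qed.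

Lemma mul_householder d (a b : 'rV[R]_d) : dot a a = dot b b ->
  a *m householder a b = b.
Proof.
move=> ab; rewrite /householder mulmxBr mulmx1 -scalemxAr mulmxA.
have -> : a *m (b - a)^T = (dot a (b - a))%:M by rewrite [LHS]mx11_scalar.
rewrite mul_scalar_mx scalerA.
have E : dot (b - a) (b - a) = - (2 * dot a (b - a)).
  rewrite dotDl !dotDr -scaleN1r !dotZl !dotZr (dotC b a) ab; ring.
have [v0|v0] := eqVneq (dot (b - a) (b - a)) 0.
  by rewrite v0 invr0 mulr0 mul0r scale0r subr0; move/dot_eq0/eqP: v0; rewrite subr_eq0 => /eqP.
have -> : 2 / dot (b - a) (b - a) * dot a (b - a) = -1.
  have : dot a (b - a) != 0 by apply: contraNneq v0 => z; rewrite E z mulr0 oppr0.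
  by rewrite E => ?; field.
by rewrite scaleN1r opprK addrC subrK.
Qed.

Lemma row_householder d (a b : 'rV[R]_d) j : a 0 j = 0 -> b 0 j = 0 ->
  row j (householder a b) = row j 1%:M.
Proof.
move=> aj bj; apply/rowP => k; rewrite !mxE big1 ?mulr0 ?subr0// => i _.
by rewrite (ord1 i) !mxE aj bj subrr mul0r.
Qed.

End Householder.
(** * Measurability *)

Section Measurability.
Context {R : realType} {disp : measure_display} {T : measurableType disp}.

(** Stated entrywise, so that it applies to plain matrix types as well as to [measurable_mx]. *)
Definition measurable_mxfun m n (F : T -> 'M[R]_(m, n)) : Prop :=
  forall i j, measurable_fun setT (fun x => F x i j).

Lemma measurable_mxfun_measurable m n (F : T -> measurable_mx R m n) :
  measurable_mxfun F -> measurable_fun setT F.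
Proof.
move=> mF.
apply: (@measurability _ _ T (measurable_mx R m n) setT F (@mx_entry_sets R m n)) => //.
move=> _ [_ [[i j] _ [Y mY <-]] <-].
rewrite !setTI; rewrite -[X in measurable X]setTI; exact: mF.
Qed.

Lemma measurable_mxM m n p (F : T -> 'M[R]_(m, n)) (G : T -> 'M[R]_(n, p)) :
  measurable_mxfun F -> measurable_mxfun G -> measurable_mxfun (fun x => F x *m G x).
Proof.
move=> mF mG i j; under eq_fun do rewrite mxE.
by apply: measurable_sum => k; apply: measurable_funM.
Qed.

Lemma measurable_mxD m n (F G : T -> 'M[R]_(m, n)) :
  measurable_mxfun F -> measurable_mxfun G -> measurable_mxfun (fun x => F x + G x).
Proof.
by move=> mF mG i j; under eq_fun do rewrite mxE; exact: measurable_funD.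
Qed.

Lemma measurable_mx_cst m n (A : 'M[R]_(m, n)) : measurable_mxfun (fun=> A).
Proof. by move=> i j; exact: measurable_cst. Qed.

Lemma measurable_mx_tr m n (F : T -> 'M[R]_(m, n)) :
  measurable_mxfun F -> measurable_mxfun (fun x => (F x)^T).
Proof. by move=> mF i j; under eq_fun do rewrite mxE; exact: mF. Qed.

Lemma measurable_mx_row m n (F : T -> 'M[R]_(m, n)) i :
  measurable_mxfun F -> measurable_mxfun (fun x => row i (F x)).
Proof. by move=> mF ? j; under eq_fun do rewrite mxE; exact: mF. Qed.

Lemma measurable_det n (F : T -> 'M[R]_n) :
  measurable_mxfun F -> measurable_fun setT (fun x => \det (F x)).
Proof.
move=> mF; rewrite /determinant; apply: measurable_sum => s.
apply: measurable_funM; first exact: measurable_cst.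
by apply: measurable_prod => i _; exact: mF.
Qed.

Lemma measurable_adj n (F : T -> 'M[R]_n) :
  measurable_mxfun F -> measurable_mxfun (fun x => \adj (F x)).
Proof.
move=> mF i j; under eq_fun do rewrite mxE /cofactor.
apply: measurable_funM; first exact: measurable_cst.
by apply: measurable_det => k l; under eq_fun do rewrite !mxE; exact: mF.
Qed.

Lemma measurable_dot n (F G : T -> 'rV[R]_n) :
  measurable_mxfun F -> measurable_mxfun G ->
  measurable_fun setT (fun x => dot (F x) (G x)).
Proof. by move=> mF mG; apply: measurable_mxM => //; exact: measurable_mx_tr. Qed.

Lemma measurable_gram n d (F : T -> 'M[R]_(n, d)) :
  measurable_mxfun F -> measurable_mxfun (fun x => gram_mx (F x)).
Proof. by move=> mF; apply: measurable_mxM => //; exact: measurable_mx_tr. Qed.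

Lemma measurable_set_bool (b : T -> bool) :
  measurable_fun setT b -> measurable [set x | b x].
Proof.
move=> mb; rewrite (_ : [set x | b x] = setT `&` b @^-1` [set true]); last first.
  by rewrite setTI; apply/seteqP; split.
exact: mb.
Qed.

Lemma measurable_set_lt (f g : T -> R) : measurable_fun setT f ->
  measurable_fun setT g -> measurable [set x | f x < g x].
Proof. by move=> mf mg; apply: measurable_set_bool; exact: measurable_fun_ltr. Qed.

Lemma measurable_set_le (f g : T -> R) : measurable_fun setT f ->
  measurable_fun setT g -> measurable [set x | f x <= g x].
Proof. by move=> mf mg; apply: measurable_set_bool; exact: measurable_fun_ler. Qed.

Lemma measurable_set_eq (f g : T -> R) : measurable_fun setT f ->
  measurable_fun setT g -> measurable [set x | f x = g x].
Proof.
move=> mf mg; rewrite (_ : [set x | _] = [set x | f x <= g x] `&` [set x | g x <= f x]).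
  by apply: measurableI; exact: measurable_set_le.
apply/seteqP; split => x /=; first by move=> ->.
by move=> [fg gf]; apply/eqP; rewrite eq_le fg gf.
Qed.

Lemma measurable_set_neq (f g : T -> R) : measurable_fun setT f ->
  measurable_fun setT g -> measurable [set x | f x != g x].
Proof.
move=> mf mg; rewrite (_ : [set x | _] = ~` [set x | f x = g x]).
  by apply: measurableC; exact: measurable_set_eq.
by apply/seteqP; split => x /= /eqP.
Qed.

Lemma measurable_set_forall (I : finType) (E : I -> set T) :
  (forall i, measurable (E i)) -> measurable [set x | forall i, E i x].
Proof.
move=> mE; rewrite (_ : [set x | _] = \bigcap_(i in setT) E i).
  by apply: fin_bigcap_measurable.
by apply/seteqP; split => x /= h i; [move=> _|]; exact: h.
Qed.

Lemma measurable_set_exists (I : finType) (E : I -> set T) :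
  (forall i, measurable (E i)) -> measurable [set x | exists i, E i x].
Proof.
move=> mE; rewrite (_ : [set x | _] = \bigcup_(i in setT) E i).
  by apply: fin_bigcup_measurable.
by apply/seteqP; split => x /= [i]; [exists i|move=> _; exists i].
Qed.

Lemma measure_exists_le (mu : {measure set T -> \bar R}) (I : finType)
    (P : pred I) (E : I -> set T) : (forall i, measurable (E i)) ->
  (mu [set x | exists2 i, P i & E i x] <= \sum_(i | P i) mu (E i))%E.
Proof.
move=> mE; rewrite -big_enum.
have -> : [set x | exists2 i, P i & E i x] =
    [set x | exists2 i, i \in enum P & E i x].
  apply/seteqP; split => x /= [i Pi Ex]; exists i => //; first by rewrite mem_enum.
  by rewrite mem_enum in Pi.
elim: (enum P) => [|i s IH].
  rewrite big_nil (_ : [set x | _] = set0) ?measure0//.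
  by apply/seteqP; split => x //= [].
have mS : measurable [set x | exists2 i, i \in s & E i x].
  rewrite (_ : [set x | _] = [set x | exists i : seq_sub s, E (val i) x]).
    exact: measurable_set_exists.
  apply/seteqP; split => x /= [j]; first by move=> js Ex; exists (SeqSub js).
  by move=> Ex; exists (val j) => //; exact: valP.
rewrite big_cons.
rewrite (_ : [set x | _] = E i `|` [set x | exists2 i, i \in s & E i x]).
  exact: le_trans (measureU2 _ (mE i) mS) (leeD2l _ IH).
apply/seteqP; split => x /=.
  move=> [j]; rewrite inE => /orP[/eqP ->|js] Ex; first by left.
  by right; exists j.
move=> [Ex|[j js Ex]]; first by exists i => //; exact: mem_head.
by exists j => //; rewrite inE js orbT.
Qed.

End Measurability.

Lemma measurable_mxfun_id (R : realType) m n :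
  measurable_mxfun (fun A : measurable_mx R m n => A).
Proof.
move=> i j _ Y mY; apply: sub_sigma_algebra; exists (i, j) => //.
by exists Y.
Qed.

Lemma measurable_mxfun_comp (R : realType) disp (T : measurableType disp) m n
    (X : T -> measurable_mx R m n) : measurable_fun setT X -> measurable_mxfun X.
Proof.
move=> mX i j.
exact: (measurableT_comp (@measurable_mxfun_id R m n i j) mX).
Qed.
(** * Averaging over reflections *)

Section HaarAverage.
Variables (R : realType) (d : nat) (mu : probability (measurable_mx R d d) R).
Hypothesis haar : haar_orthogonal mu.

Lemma measurable_orthogonal : measurable (@orthogonal_mx R d : set (measurable_mx R d d)).
Proof.
rewrite (_ : @orthogonal_mx R d = [set U : measurable_mx R d d |
    forall i, forall j, (U *m U^T) i j = (1%:M : 'M[R]_d) i j]).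
  apply: measurable_set_forall => i; apply: measurable_set_forall => j.
  apply: measurable_set_eq; last exact: measurable_cst.
  exact: measurable_gram (@measurable_mxfun_id R d d) _ _.
apply/seteqP; split => U /=; first by rewrite /orthogonal_mx /= => ->.
by move=> h; apply/matrixP.
Qed.

Lemma measurable_mulmx_left (Q : 'M[R]_d) :
  measurable_fun setT (fun U : measurable_mx R d d => Q *m U : measurable_mx R d d).
Proof.
apply: measurable_mxfun_measurable; apply: measurable_mxM.
  exact: measurable_mx_cst.
exact: measurable_mxfun_id.
Qed.

Lemma haar_integral (Q : 'M[R]_d) (k : measurable_mx R d d -> \bar R) :
  orthogonal_mx Q -> measurable_fun setT k -> (forall U, 0 <= k U)%E ->
  (\int[mu]_U k (Q *m U) = \int[mu]_U k U)%E.
Proof.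
move=> oQ mk k0.
have mQ := measurable_mulmx_left Q.
have := @ge0_integral_pushforward _ _ _ _ R _ mQ mu setT k measurableT mk (fun U _ => k0 U).
rewrite preimage_setT => <-.
by apply: eq_measure_integral => B mB _; exact: haar.2.
Qed.

(* All left translates of [k] have the same integral, so a pointwise bound on
   their average over any finite family bounds the integral of [k]. *)
Lemma haar_average (I : finType) (Q : I -> 'M[R]_d) (k : measurable_mx R d d -> R)
    (N b : R) :
  (forall i, orthogonal_mx (Q i)) -> measurable_fun setT k -> (forall U, 0 <= k U) ->
  #|I|%:R = N -> 0 < N -> 0 <= b ->
  (forall U, orthogonal_mx U -> \sum_i k (Q i *m U) <= N * b) ->
  (\int[mu]_U (k U)%:E <= b%:E)%E.
Proof.
move=> oQ mk k0 IN N0 b0 kb.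
have mk' i : measurable_fun setT (fun U : measurable_mx R d d => k (Q i *m U)).
  exact: measurableT_comp mk (measurable_mulmx_left (Q i)).
have J0 : (0 <= \int[mu]_U (k U)%:E)%E by apply: integral_ge0 => U _; rewrite lee_fin.
have key : (N%:E * \int[mu]_U (k U)%:E <= (N * b)%:E)%E.
  have -> : (N%:E * \int[mu]_U (k U)%:E = \int[mu]_U (\sum_i (k (Q i *m U))%:E))%E.
    rewrite ge0_integral_sum//; last 2 first.
      by move=> i; apply/measurable_EFinP; exact: mk'.
      by move=> i U _; rewrite lee_fin.
    have E i : (\int[mu]_U (k (Q i *m U))%:E = \int[mu]_U (k U)%:E)%E.
      by apply: (@haar_integral (Q i) (fun U => (k U)%:E)) => //; exact/measurable_EFinP.
    under eq_bigr do rewrite E.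
    rewrite -IN cardE -big_enum; elim: (enum I) => [|i s IH].
      by rewrite big_nil mul0e.
    by rewrite big_cons -IH /= -natr1 addrC EFinD ge0_muleDl ?mul1e// lee_fin.
  have -> : (N * b)%:E = (\int[mu]_(U in setT) (N * b)%:E)%E.
    rewrite integral_cst// [X in (_ * X)%E](_ : _ = 1%E) ?mule1//.
    exact: probability_setT.
  (* The pointwise bound is known for orthogonal [U] only, a set of full measure. *)
  apply: ae_ge0_le_integral => //.
  - by move=> U _; apply: sume_ge0 => i _; rewrite lee_fin.
  - by apply: emeasurable_sum => i; apply/measurable_EFinP; exact: mk'.
  - by move=> U _; rewrite lee_fin mulr_ge0// ltW.
  exists (~` @orthogonal_mx R d); split.
  - by apply: measurableC; exact: measurable_orthogonal.
  - apply: etrans (probability_setC mu measurable_orthogonal) _.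
    by rewrite haar.1 subee.
  - move=> U /= nU oU; apply: nU => _.
    by rewrite sumEFin lee_fin; exact: kb.
by move: key; rewrite EFinM lee_pmul2l// lte_fin.
Qed.

End HaarAverage.

(** * Tail bounds under the Haar measure *)

Section HaarTails.
Variables (R : realType) (n d : nat) (hn : (1 <= n)%N) (hnd : (n <= d)%N).
Variable lambda : 'rV[R]_d.
Hypothesis lambda_gt0 : forall j, 0 < lambda ord0 j.

Let D : 'M[R]_d := diag_mx (map_mx Num.sqrt lambda).
Let F (U : 'M[R]_d) : 'M[R]_(n, d) := feature_mx lambda (scaled_rows hnd U).
Let t : R := \sum_j `|lambda ord0 j|.
Let L : R := \big[Num.max/0]_j `|lambda ord0 j|.

Let d_gt0 : (0 < d)%N. Proof. exact: leq_trans hn hnd. Qed.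

Let lambda_le k : lambda 0 k <= L.
Proof.
rewrite /L (bigD1 k)//= le_max; apply/orP; left; exact: ler_norm.
Qed.

Let L_gt0 : 0 < L.
Proof. exact: lt_le_trans (lambda_gt0 (Ordinal d_gt0)) (lambda_le _). Qed.

Let sqrtd_gt0 : 0 < Num.sqrt (d%:R : R).
Proof. by rewrite sqrtr_gt0 ltr0n. Qed.

Lemma dot_mul_orth (U : 'M[R]_d) (x : 'rV_d) : orthogonal_mx U ->
  dot (x *m U) (x *m U) = dot x x.
Proof. by move=> oU; rewrite dot_mulmx -mulmxA oU mulmx1. Qed.

Lemma orth_tr (U : 'M[R]_d) : orthogonal_mx U -> orthogonal_mx U^T.
Proof. by move=> oU; rewrite /orthogonal_mx /= trmxK; exact: mulmx1C. Qed.

Lemma dot_mul_diag (x : 'rV[R]_d) : dot (x *m D) (x *m D) <= L * dot x x.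
Proof.
rewrite !dotE mulr_sumr; apply: ler_sum => k _.
rewrite mul_mx_diag !mxE mulrACA -!expr2 sqr_sqrtr; last exact: ltW.
by rewrite mulrC ler_wpM2r// sqr_ge0.
Qed.

(** The columns of [U] are unit vectors, so the quadratic form in signs has the same mean for every
    orthogonal [U]. *)
Lemma sum_sqr_orth_diag (U : 'M[R]_d) : orthogonal_mx U ->
  \sum_j \sum_k (U *m D) j k ^+ 2 = t.
Proof.
move=> /orth_tr oU; rewrite exchange_big; apply: eq_bigr => k _ /=.
rewrite (eq_bigr (fun j => U j k ^+ 2 * lambda 0 k)) => [|j _]; last first.
  by rewrite mul_mx_diag !mxE exprMn sqr_sqrtr// ltW.
rewrite -mulr_suml gtr0_norm// -[RHS]mul1r; congr (_ * _).
have /matrixP /(_ k k) := oU; rewrite !mxE eqxx mulr1n => <-.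
by apply: eq_bigr => j _; rewrite !mxE expr2.
Qed.

Lemma mul_features (v : 'rV[R]_n) U :
  v *m F U = Num.sqrt d%:R *: (v *m rowsub (widen_ord hnd) 1%:M *m U *m D).
Proof.
rewrite /F /feature_mx /scaled_rows -/D -scalemxAl -scalemxAr -!mulmxA.
by congr (_ *: (_ *m _)); rewrite !mul_rowsub_mx mul1mx.
Qed.

Lemma rowsub1_tr :
  rowsub (widen_ord hnd) 1%:M *m (rowsub (widen_ord hnd) 1%:M)^T = 1%:M :> 'M[R]_n.
Proof.
rewrite mul_rowsub_mx mul1mx; apply/matrixP => i j; rewrite !mxE.
by rewrite -(inj_eq val_inj) eq_sym.
Qed.

Lemma measurable_features : measurable_mxfun (fun U : measurable_mx R d d => F U).
Proof.
move=> i j; under eq_fun do rewrite /F /feature_mx mul_mx_diag !mxE.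
apply: measurable_funM; last exact: measurable_cst.
apply: measurable_funM; first exact: measurable_cst.
exact: measurable_mxfun_id.
Qed.

Lemma measurable_qform disp (T : measurableType disp) (G : T -> 'M[R]_(n, d)) v :
  measurable_mxfun G -> measurable_fun setT (fun x => qform (G x) v).
Proof.
move=> mG; apply: measurable_sum => k; apply: measurable_funX.
apply: measurable_sum => j; apply: measurable_funM; first exact: measurable_cst.
exact: mG.
Qed.

(* [true] stands for the sign -1. *)
Definition signs m (e : {ffun 'I_m -> bool}) : 'rV[R]_m := \row_i (-1) ^+ e i.

Variable mu : probability (measurable_mx R d d) R.
Hypothesis haar : haar_orthogonal mu.

Let card_signs : #|{: {ffun 'I_d -> bool}}|%:R = 2 ^+ d :> R.
Proof. by rewrite card_ffun card_bool card_ord natrX. Qed.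

Lemma indic_le (T : Type) (E : set T) x (v : R) : 0 <= v -> (E x -> 1 <= v) ->
  \1_E x <= v.
Proof.
move=> v0 v1; rewrite indicE; have [/set_mem /v1//|_] := boolP (x \in E).
exact: v0.
Qed.

Definition qform_bad w (A : 'M[R]_(n, d)) : Prop :=
  ~ (t / 4 * sqn w <= qform A w <= 4 * t * sqn w).

Lemma measurable_qform_bad w :
  measurable [set A : measurable_mx R n d | qform_bad w A].
Proof.
have mq := @measurable_qform _ _ _ w (@measurable_mxfun_id R n d).
rewrite [X in measurable X](_ : _ = ~` (
    [set A : measurable_mx R n d | t / 4 * sqn w <= qform A w] `&`
    [set A : measurable_mx R n d | qform A w <= 4 * t * sqn w])).
  by apply/measurableC/measurableI; apply: measurable_set_le.
apply/seteqP; split => A /= bad; first by move=> [h1 h2]; apply: bad; rewrite h1.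
by move=> /andP.
Qed.

Lemma qform_bad_prob w :
  (mu [set U | qform_bad w (F U)] <=
   (expR (- (eff_dim lambda / 128)) + expR (- (eff_dim lambda / 32)))%:E)%E.
Proof.
set E := [set U | _]; set b := expR _ + expR _.
have b0 : 0 <= b by rewrite addr_ge0// expR_ge0.
(* For [w = 0] both bounds hold with equality and the event is empty; otherwise [w] can be
   normalised. *)
have [w0|w0] := eqVneq (sqn w) 0.
  rewrite (_ : E = set0) ?measure0 ?lee_fin//.
  apply/seteqP; split => U //=; apply; rewrite w0 !mulr0 qform_ge0/=.
  have w00 i : w i = 0.
    have /psumr_eq0P : \sum_i w i ^+ 2 = 0 by exact: w0.
    by move=> /(_ (fun _ _ => sqr_ge0 _)) /(_ i isT)/eqP; rewrite sqrf_eq0 => /eqP.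
  rewrite /qform big1// => k _; rewrite big1 ?expr0n// => j _.
  by rewrite w00 mul0r.
have wp : 0 < sqn w by rewrite lt_def w0 sqn_ge0.
have mE : measurable (E : set (measurable_mx R d d)).
  rewrite -[E]setTI.
  exact: (measurable_mxfun_measurable measurable_features) measurableT _ (measurable_qform_bad w).
have -> : mu E = (\int[mu]_U (\1_E U)%:E)%E by rewrite integral_indic// setIT.
pose v : 'rV[R]_n := \row_i w i.
pose s := Num.sqrt (sqn w).
have s0 : 0 < s by rewrite sqrtr_gt0.
have vw : dot v v = s ^+ 2.
  rewrite sqr_sqrtr ?sqn_ge0// dotE; apply: eq_bigr => i _.
  by rewrite mxE expr2.
(* [a] is [w] normalised and padded with zeros to a unit vector of [R^d]. *)
pose a : 'rV[R]_d := s^-1 *: (v *m rowsub (widen_ord hnd) 1%:M).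
pose be (e : {ffun 'I_d -> bool}) : 'rV[R]_d := (Num.sqrt d%:R)^-1 *: signs e.
have a1 : dot a a = 1.
  rewrite /a dotZl dotZr dot_mulmx -mulmxA rowsub1_tr mulmx1 vw.
  by field; rewrite gt_eqF.
have b1 e : dot (be e) (be e) = 1.
  rewrite /be dotZl dotZr dotE (eq_bigr (fun=> 1)) => [|i _]; last first.
    by rewrite !mxE -expr2 sqrr_sign.
  rewrite sumr_const card_ord mulrA -invfM -expr2 sqr_sqrtr ?ler0n//.
  by rewrite mulVf// pnatr_eq0 -lt0n.
(* The factor [sqrt d] of the feature model cancels the normalisation of the sign vector. *)
have step e U : qform (F (householder a (be e) *m U)) w =
    sqn w * qform (U *m D) (fun i => (-1) ^+ e i).
  have -> : w = fun i => v 0 i by apply/funext => i; rewrite mxE.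
  rewrite -dot_qform mul_features mulmxA.
  have -> : v *m rowsub (widen_ord hnd) 1%:M = s *: a.
    by rewrite scalerA divff ?scale1r// gt_eqF.
  rewrite -scalemxAl mul_householder ?a1 ?b1// /be -!scalemxAl !scalerA.
  rewrite mulrCA divff ?mulr1 ?gt_eqF// dotZl dotZr -mulmxA dot_qform mulrA -expr2.
  have -> : (fun i => signs e 0 i) = (fun i => (-1) ^+ e i).
    by apply/funext => i; rewrite mxE.
  by rewrite -dot_sqn vw.
apply: (@haar_average R d mu haar {ffun 'I_d -> bool} (fun e => householder a (be e))
  \1_E (2 ^+ d) b _ _ _ card_signs (exprn_gt0 _ _) b0) => //.
  by move=> e; exact: householder_orth.
move=> U oU; pose q := qform (U *m D).
have trE : \sum_j \sum_k (U *m D) j k ^+ 2 = t by exact: sum_sqr_orth_diag.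
have qL x : q x <= L * \sum_i x i ^+ 2.
  have -> : x = fun i => (\row_i x i) 0 i by apply/funext => i; rewrite mxE.
  rewrite /q -dot_qform mulmxA (le_trans (dot_mul_diag _))// dot_mul_orth//.
  by rewrite dot_sqn.
have lo := cube_quad_lower L_gt0 qL.
have up := cube_quad_upper L_gt0 qL.
rewrite trE in lo up.
apply: (@le_trans _ _ (2 ^+ d * (cube_avg (fun x => (q x < t / 4)%R%:R) +
   cube_avg (fun x => (4 * t < q x)%R%:R)))); last first.
  by rewrite ler_pM2l ?exprn_gt0// lerD.
rewrite -cube_avgD cube_avg_sum; apply: ler_sum => e _.
apply: indic_le; first by rewrite addr_ge0.
rewrite /E /= /qform_bad step => bad.
case: ltP => [_|h1]; first by rewrite lerDl.
case: ltP => [_|h2]; first by rewrite lerDr.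
exfalso; apply: bad; rewrite mulrC ler_pM2l// h1 mulrC ler_pM2r//.
Qed.

Let m : R := d%:R - n%:R + 1.

Let m_gt0 : 0 < m.
Proof. by rewrite /m ltr_wpDl// subr_ge0 ler_nat. Qed.

Lemma measurable_zero_row i :
  measurable_mxfun (fun A : measurable_mx R n d => zero_row i A).
Proof.
move=> j k; under eq_fun do rewrite mxE.
by case: (j == i); [exact: measurable_cst|exact: measurable_mxfun_id].
Qed.

Lemma measurable_loo_gram i :
  measurable_mxfun (fun A : measurable_mx R n d => loo_gram i A).
Proof.
apply: measurable_mxD; last exact: measurable_mx_cst.
by apply: measurable_gram; exact: measurable_zero_row.
Qed.

Lemma measurable_loo_vec i y :
  measurable_mxfun (fun A : measurable_mx R n d => loo_vec i y A).
Proof.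
apply: measurable_mxM; last exact: measurable_zero_row.
apply: measurable_mxM; first exact: measurable_mx_cst.
by apply: measurable_adj; exact: measurable_loo_gram.
Qed.

Lemma measurable_loo_bad V i y :
  measurable [set A : measurable_mx R n d | loo_bad V i y A].
Proof.
have mD := measurable_det (measurable_loo_gram i).
have mv := @measurable_loo_vec i y.
rewrite [X in measurable X](_ : _ =
  [set A : measurable_mx R n d | \det (loo_gram i A) != 0] `&`
  ([set A : measurable_mx R n d |
     dot (loo_vec i y A) (loo_vec i y A) <= V * \det (loo_gram i A) ^+ 2] `&`
   [set A : measurable_mx R n d |
     `|\det (loo_gram i A)| <= `|dot (loo_vec i y A) (row i A)| ])).
  apply: measurableI; first by apply: measurable_set_neq => //; exact: measurable_cst.
  apply: measurableI; apply: measurable_set_le.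
  - exact: measurable_dot.
  - by apply: measurable_funM; [exact: measurable_cst|exact: measurable_funX].
  - exact: measurableT_comp.
  - apply: measurableT_comp => //; apply: measurable_dot => //.
    by apply: measurable_mx_row; exact: measurable_mxfun_id.
by apply/seteqP; split => A /= => [[]|[? []]].
Qed.

Section LooTail.
Variable i : 'I_n.
Let ii := widen_ord hnd i.
Let inS (l : 'I_d) : bool := (l == ii) || (n <= l)%N.
(** A random unit vector supported on the rows to be mixed. Signs outside [inS] have no effect, so
    indexing by the full cube only repeats each vector equally often. *)
Let q (e : {ffun 'I_d -> bool}) : 'rV[R]_d :=
  (Num.sqrt m)^-1 *: \row_l ((inS l)%:R * (-1) ^+ e l).
Let Q e := householder (delta_mx 0 ii) (q e).

Let sum_inS : \sum_l (inS l)%:R = m.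
Proof.
have -> : \sum_l (inS l)%:R = \sum_(l < d) ((l == ii)%:R + (1 - (l < n)%N%:R)) :> R.
  apply: eq_bigr => l _; rewrite /inS ltnNge; case: eqP => [->|_] /=.
    by rewrite leqNgt ltn_ord /= subrr addr0.
  by case: (n <= l)%N; rewrite /= ?subr0 ?subrr ?add0r ?addr0.
rewrite big_split sumrB /= (bigD1 ii)//= eqxx big1 => [|l /negbTE ->//].
rewrite sumr_const card_ord.
have -> : \sum_(l < d) ((l < n)%N%:R : R) = \sum_(l < d | (l < n)%N) (1 : R).
  by rewrite [RHS]big_mkcond; apply: eq_bigr => l _; case: ifP.
rewrite -(big_ord_widen d (fun=> 1 : R) hnd) sumr_const card_ord /m.
by rewrite addr0 addrC.
Qed.

Let q_unit e : dot (q e) (q e) = dot (delta_mx 0 ii) (delta_mx 0 ii).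
Proof.
rewrite dot_delta mxE !eqxx /q dotZl dotZr dotE.
rewrite (eq_bigr (fun l => (inS l)%:R)) => [|l _]; last first.
  rewrite !mxE mulrACA -expr2 -[X in _ * X]expr2 sqrr_sign mulr1.
  by case: inS; rewrite /= ?expr1n ?expr0n.
rewrite sum_inS mulrA -invfM -expr2 sqr_sqrtr ?mulVf//; last exact: ltW.
by rewrite gt_eqF.
Qed.

Let row_Q e (U : 'M[R]_d) (j : 'I_n) : j != i ->
  row (widen_ord hnd j) (Q e *m U) = row (widen_ord hnd j) U.
Proof.
move=> ji; have ji' : (widen_ord hnd j == ii) = false by exact: negbTE ji.
rewrite row_mul row_householder -?row_mul ?mul1mx//.
  by rewrite mxE ji' andbF.
have nj : (n <= widen_ord hnd j)%N = false.
  by apply/negbTE; rewrite -ltnNge /= ltn_ord.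
by rewrite !mxE /inS ji' nj mul0r mulr0.
Qed.

Let row_F U j : row j (F U) = Num.sqrt d%:R *: (row (widen_ord hnd j) U *m D).
Proof.
by apply/rowP => k; rewrite /F /feature_mx !mul_mx_diag !mxE mulrA.
Qed.

Let row_FQ e U j : j != i -> row j (F (Q e *m U)) = row j (F U).
Proof. by move=> ji; rewrite !row_F row_Q. Qed.

Let zero_row_FQ e U : zero_row i (F (Q e *m U)) = zero_row i (F U).
Proof.
apply/matrixP => j k; rewrite !mxE; case: eqP => // /eqP ji.
by have /rowP /(_ k) := row_FQ e U ji; rewrite !mxE.
Qed.

(** The reflections fix the rows other than [i], hence also [w] and [De]; only [<w, x_i>] varies, as
    the linear form with coefficients [a] in the signs. *)
Lemma loo_bad_tail (U : 'M[R]_d) y V : orthogonal_mx U -> 0 < V ->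
  \sum_e \1_[set A | loo_bad V i y A] (F (Q e *m U)) <=
  2 ^+ d * (2 * expR (- (32 * (d%:R / m * L * V))^-1)).
Proof.
move=> oU V0.
pose w := loo_vec i y (F U); pose De := \det (loo_gram i (F U)).
have V0' : 0 < d%:R / m * L * V by rewrite !mulr_gt0 ?ltr0n ?invr_gt0.
(* If one of the first two conditions of [loo_bad] fails, it fails for all reflections and every
   term vanishes. *)
have [/andP[De0 wV]|nb] := boolP ((De != 0) && (dot w w <= V * De ^+ 2)); last first.
  apply: (@le_trans _ _ 0); last by rewrite !mulr_ge0 ?exprn_ge0 ?expR_ge0.
  rewrite big1// => e _; rewrite indicE memNset//= /loo_bad /loo_vec /loo_gram.
  by rewrite zero_row_FQ => -[b1 b2 _]; move: nb; rewrite b1 b2.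
pose z := w *m D *m U^T.
pose a l := Num.sqrt d%:R / Num.sqrt m * (inS l)%:R * z 0 l.
have dotw e : dot w (row i (F (Q e *m U))) = \sum_l a l * (-1) ^+ e l.
  rewrite row_F -/ii row_mul.
  have -> : row ii (Q e) = q e by rewrite rowE mul_householder.
  rewrite dotZr dotC !dot_mulmx /D tr_diag_mx -/D -/z /q dotZl dotE !mulr_sumr.
  by apply: eq_bigr => l _; rewrite mxE /a; ring.
have aV : \sum_l a l ^+ 2 <= d%:R / m * L * V * De ^+ 2.
  apply: (@le_trans _ _ (d%:R / m * dot z z)).
    rewrite dotE mulr_sumr; apply: ler_sum => l _.
    have -> : a l ^+ 2 = Num.sqrt d%:R ^+ 2 / Num.sqrt m ^+ 2 *
        ((inS l)%:R ^+ 2 * z 0 l ^+ 2).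
      by rewrite /a; field; rewrite gt_eqF// sqrtr_gt0.
    rewrite !sqr_sqrtr ?ler0n//; last exact: ltW.
    rewrite -expr2 ler_wpM2l//; first by rewrite divr_ge0// ltW.
    by case: inS; rewrite /= ?expr1n ?mul1r// expr0n mul0r sqr_ge0.
  rewrite dot_mul_orth; last exact: orth_tr.
  rewrite -!mulrA ler_wpM2l ?ler0n// ler_wpM2l//; first by rewrite invr_ge0 ltW.
  by rewrite (le_trans (dot_mul_diag _))// ler_wpM2l// ltW.
have := cube_linear_tail De0 V0' aV.
rewrite -(ler_pM2l (_ : 0 < 2 ^+ d)) ?exprn_gt0// cube_avg_sum.
apply: le_trans; apply: ler_sum => e _; apply: indic_le => //=.
rewrite /loo_bad /loo_vec /loo_gram zero_row_FQ => -[_ _].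
by rewrite -/(loo_gram _ _) -/(loo_vec _ _ _) -/De -/w dotw => ->.
Qed.

(** The weight [p s] stands for the conditional probability of the labels other than the [i]-th. It
    ignores row [i], so it is constant over the reflections and factors out. The total is 2 rather
    than 1 because both signs of label [i] are counted. *)
Lemma loo_bad_prob V (p : {ffun 'I_n -> bool} -> measurable_mx R n d -> R) :
  0 < V -> (forall s, measurable_fun setT (p s)) -> (forall s A, 0 <= p s A) ->
  (forall s A B, (forall j, j != i -> row j A = row j B) -> p s A = p s B) ->
  (forall A, \sum_s p s A <= 2) ->
  (\int[mu]_U (\sum_s p s (F U) *
     \1_[set A | loo_bad V i (signs s) A] (F U))%:E <=
   (4 * expR (- (32 * (d%:R / m * L * V))^-1))%:E)%E.
Proof.
move=> V0 mp p0 pi psum.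
have mF : measurable_fun setT (fun U : measurable_mx R d d => F U : measurable_mx R n d).
  exact: measurable_mxfun_measurable measurable_features.
set b := expR _; have b0 : 0 <= 4 * b by rewrite mulr_ge0 ?expR_ge0.
apply: (@haar_average R d mu haar {ffun 'I_d -> bool} Q
   (fun U => \sum_s p s (F U) * \1_[set A | loo_bad V i (signs s) A] (F U))
   (2 ^+ d) _ _ _ _ card_signs (exprn_gt0 _ _) b0) => //.
- by move=> e; exact: householder_orth.
- apply: measurable_sum => s; apply: measurable_funM.
    exact: measurableT_comp (mp s) mF.
  by apply: measurableT_comp mF; apply: measurable_indic; exact: measurable_loo_bad.
- by move=> U; apply: sumr_ge0 => s _; rewrite mulr_ge0// indicE.
move=> U oU; rewrite exchange_big /=.
apply: (@le_trans _ _ (\sum_s p s (F U) * (2 ^+ d * (2 * b)))).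
  apply: ler_sum => s _.
  rewrite (eq_bigr (fun e => p s (F U) * \1_[set A | loo_bad V i (signs s) A] (F (Q e *m U)))).
    by rewrite -mulr_sumr ler_wpM2l// loo_bad_tail.
  by move=> e _; rewrite (pi s _ (F U))// => j ji; exact: row_FQ.
rewrite -mulr_suml (_ : 2 ^+ d * (4 * b) = 2 * (2 ^+ d * (2 * b))); last by ring.
by rewrite ler_wpM2r// !mulr_ge0 ?exprn_ge0 ?expR_ge0.
Qed.

End LooTail.

End HaarTails.
(** * The feature and label model *)

Section Model.
Variables (R : realType) (n d : nat) (hn : (1 <= n)%N) (hnd : (n <= d)%N).
Variable lambda : 'rV[R]_d.
Hypothesis lambda_gt0 : forall j, 0 < lambda ord0 j.
Variables (disp : measure_display) (T : measurableType disp) (P : probability T R).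
Variables (X : {RV P >-> measurable_mx R n d}) (y : 'I_n -> {RV P >-> R}).
Variable mu : probability (measurable_mx R d d) R.
Hypothesis haar : haar_orthogonal mu.
Hypothesis lawX : forall B : set (measurable_mx R n d), measurable B ->
  distribution P X B = mu [set U | B (feature_mx lambda (scaled_rows hnd U))].
Hypothesis labels : label_model X y.

Let F (U : 'M[R]_d) : 'M[R]_(n, d) := feature_mx lambda (scaled_rows hnd U).
Let Y w : 'rV[R]_n := \row_k y k w.
Let t : R := \sum_j `|lambda ord0 j|.
Let L : R := \big[Num.max/0]_j `|lambda ord0 j|.
Let m : R := d%:R - n%:R + 1.
Let V : R := n%:R / (t / 64).

Let d_gt0 : (0 < d)%N. Proof. exact: leq_trans hn hnd. Qed.

Let t_gt0 : 0 < t.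
Proof.
rewrite /t (bigD1 (Ordinal d_gt0))//= ltr_pwDl ?sumr_ge0//.
by rewrite normr_gt0 gt_eqF.
Qed.

Let L_gt0 : 0 < L.
Proof.
rewrite /L (bigD1 (Ordinal d_gt0))//= lt_max; apply/orP; left.
by rewrite normr_gt0 gt_eqF.
Qed.

Let V_gt0 : 0 < V.
Proof. by rewrite !divr_gt0 ?ltr0n. Qed.

Let m_gt0 : 0 < m.
Proof. by rewrite /m ltr_wpDl// subr_ge0 ler_nat. Qed.

Let mX : measurable_mxfun (fun w => X w).
Proof. by apply: measurable_mxfun_comp; exact: measurable_funP. Qed.

Let mY : measurable_mxfun Y.
Proof. by move=> i j; under eq_fun do rewrite mxE; exact: measurable_funP. Qed.

Let mF : measurable_fun setT (fun U : measurable_mx R d d => F U : measurable_mx R n d).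
Proof. by apply: measurable_mxfun_measurable; exact: measurable_features. Qed.

Let Y2 w i : Y w 0 i ^+ 2 = 1.
Proof. by rewrite mxE; case: (labels.1 i w) => ->; rewrite ?sqrrN expr1n. Qed.

Lemma integral_law (k : measurable_mx R n d -> \bar R) :
  measurable_fun setT k -> (forall A, 0 <= k A)%E ->
  (\int[P]_w k (X w) = \int[mu]_U k (F U))%E.
Proof.
move=> mk k0.
have mX' : measurable_fun setT (X : T -> measurable_mx R n d) by exact: measurable_funP.
have <- := @ge0_integral_pushforward _ _ _ _ R _ mX' P setT k measurableT mk (fun A _ => k0 A).
have <- := @ge0_integral_pushforward _ _ _ _ R _ mF mu setT k measurableT mk (fun A _ => k0 A).
by apply: eq_measure_integral => B mB _; exact: lawX.
Qed.

Let SV := [set w | forall i, support_vector (X w) (Y w) i].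

(** The characterisation by [all_sv] replaces a quantification over dual solutions by finitely many
    polynomial conditions. *)
Lemma measurable_sv : measurable SV.
Proof.
have mG : measurable_mxfun (fun w => gram_mx (X w)) by exact: measurable_gram.
have mD := measurable_det mG.
rewrite [X in measurable X](_ : _ = [set w | \det (gram_mx (X w)) != 0] `&`
  [set w | forall i, 0 < Y w 0 i * (Y w *m \adj (gram_mx (X w))) 0 i *
                         \det (gram_mx (X w))]).
  apply: measurableI; first by apply: measurable_set_neq => //; exact: measurable_cst.
  apply: measurable_set_forall => i; apply: measurable_set_lt; first exact: measurable_cst.
  apply: measurable_funM => //; apply: measurable_funM; first exact: mY.
  by apply: measurable_mxM => //; exact: measurable_adj.
by apply/seteqP; split => w /=; move/(support_vectorP (X w) (Y2 w) hn).
Qed.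

Let bad_net := [set w | exists2 k, k \in @net n & qform_bad lambda (net_vec R k) (X w)].
Let bad_loo i := [set w | loo_bad V i (Y w) (X w)].

Lemma sv_compl_sub : ~` SV `<=` bad_net `|` [set w | exists2 i, true & bad_loo i w].
Proof.
move=> w /= nsv; have [bn|nbn] := pselect (bad_net w); [by left|right].
apply: contrapT => nbl; apply: nsv.
apply/(support_vectorP (X w) (Y2 w) hn).
have t64 : 0 < t / 64 by rewrite divr_gt0.
apply: (@not_loo_bad_all_sv R n d (X w) (Y w) _ (Y2 w) t64).
  apply: net_good_lower => //; first exact: ltW.
  by move=> k kn; apply: contrapT => bk; apply: nbn; exists k.
by move=> i bi; apply: nbl; exists i.
Qed.

(** A union bound over the net: [2 * 2 ^ (34 n) <= 2 ^ (35 n) <= expR (35 n)], using [n >= 1]. *)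
Lemma bad_net_prob :
  (P bad_net <= (expR (- (1 / 2048) * eff_dim lambda + 35 * n%:R))%:E)%E.
Proof.
set b := expR (- (eff_dim lambda / 128)) + expR (- (eff_dim lambda / 32)).
have r0 : 0 < eff_dim lambda by rewrite divr_gt0.
have mB k := @measurable_qform_bad R n d lambda (net_vec R k).
have mE k : measurable [set w | qform_bad lambda (net_vec R k) (X w)].
  have := measurable_funP X measurableT _ (mB k).
  by rewrite setTI.
apply: le_trans (measure_exists_le _ _ mE) _.
apply: (@le_trans _ _ (\sum_(k in @net n) b%:E)%E).
  apply: lee_sum => k _.
  apply: le_trans (qform_bad_prob hn hnd lambda_gt0 haar (net_vec R k)).
  by rewrite -(lawX (mB k)).
rewrite sumEFin lee_fin sumr_const -[_ *+ _]mulr_natl.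
(* The rates [1 / 128] and [1 / 32] are weakened to the one that the leave-one-out bound allows. *)
have b2 : b <= 2 * expR (- (eff_dim lambda / 2048)).
  rewrite /b mulr_natl mulr2n lerD// ler_expR; lra.
have e2 : 2 <= expR (1 : R) by have := expR_ge1Dx (1 : R); lra.
rewrite addrC expRD -[35 * n%:R]mulr1 -natrM expRM_natl.
have -> : - (1 / 2048) * eff_dim lambda = - (eff_dim lambda / 2048) by lra.
apply: (@le_trans _ _ (2 ^+ (34 * n) * (2 * expR (- (eff_dim lambda / 2048))))).
  by apply: ler_pM => //; [rewrite addr_ge0 ?expR_ge0|exact: card_net].
rewrite mulrA -exprSr ler_wpM2r ?expR_ge0//.
apply: (@le_trans _ _ (2 ^+ (35 * n))); last by rewrite lerXn2r ?nnegrE ?expR_ge0.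
rewrite ler_weXn2l ?ler1n//.
by rewrite -addn1 (_ : 35 * n = 34 * n + n)%N ?leq_add2l// -mulSnr.
Qed.

Let B i e := [set A : measurable_mx R n d | loo_bad V i (signs R e) A].

(** The negation reconciles two conventions: [true] is the sign -1 in [signs] but the label 1 in
    [label_model]. *)
Let E (e : {ffun 'I_n -> bool}) : set T :=
  [set w | forall j, y j w = if ~~ e j then 1 else -1].

Lemma measurable_cover i e : measurable (E e `&` X @^-1` B i e).
Proof.
apply: measurableI.
  apply: measurable_set_forall => j; apply: measurable_set_eq; first exact: measurable_funP.
  exact: measurable_cst.
have mB : measurable (B i e) by exact: measurable_loo_bad.
by have := measurable_funP X measurableT _ mB; rewrite setTI.
Qed.

(** Splitting by the label vector makes the labels in [loo_bad] deterministic, so that [label_model]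
    applies to each piece. *)
Lemma bad_loo_cover i :
  bad_loo i = [set w | exists2 e, true & (E e `&` X @^-1` B i e) w].
Proof.
have YE w e : E e w -> Y w = signs R e.
  by move=> Ew; apply/rowP => j; rewrite !mxE Ew; case: (e j).
apply/seteqP; split => w; last first.
  by move=> [e _ [Ew]]; rewrite /bad_loo /= (YE _ _ Ew).
move=> bw; pose e := [ffun j => y j w == -1].
have Ee : E e w.
  move=> j; rewrite ffunE; have [//|ne] := eqVneq (y j w) (-1).
  by case: (labels.1 j w) => // yE; rewrite yE eqxx in ne.
by exists e => //; split=> //; rewrite /B /= -(YE _ _ Ee).
Qed.

Lemma measurable_bad_loo i : measurable (bad_loo i).
Proof.
rewrite bad_loo_cover (_ : [set w | _] =
  [set w | exists e, (E e `&` X @^-1` B i e) w]).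
  by apply: measurable_set_exists => e; exact: measurable_cover.
by apply/seteqP; split => w /= [e]; exists e.
Qed.

(** The conditional probability of a label vector is a product over the examples. Bounding the
    factor of example [i] by 1 leaves a weight free of row [i], at the cost of a factor 2. *)
Lemma bad_loo_prob i :
  (P (bad_loo i) <= (4 * expR (- (32 * (d%:R / m * L * V))^-1))%:E)%E.
Proof.
have [eta [meta [eta01 cond]]] := labels.2.
pose f (e : bool) (j : 'I_n) (A : measurable_mx R n d) : R :=
  if ~~ e then eta j (row j A) else 1 - eta j (row j A).
have f01 e j A : 0 <= f e j A <= 1.
  by have := eta01 j (row j A); rewrite /f; case: e => /=; lra.
have f1 j A : f true j A + f false j A = 1 by rewrite /f /=; lra.
have mf e j : measurable_fun setT (f e j).
  have me : measurable_fun setT (fun A : measurable_mx R n d => eta j (row j A)).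
    apply: measurableT_comp (meta j) _; apply: measurable_mxfun_measurable.
    by apply: measurable_mx_row; exact: measurable_mxfun_id.
  by rewrite /f; case: e => //=; apply: measurable_funB => //; exact: measurable_cst.
pose p (e : {ffun 'I_n -> bool}) A := \prod_(j | j != i) f (e j) j A.
have p0 e A : 0 <= p e A.
  by apply: prodr_ge0 => j _; case/andP: (f01 (e j) j A).
have mp e : measurable_fun setT (p e).
  rewrite /p; under eq_fun do rewrite big_mkcond.
  by apply: measurable_prod => j _; case: (j != i); [exact: mf|exact: measurable_cst].
(* By distributivity, each [j != i] contributes 1 and the index [i] contributes [1 + 1]. *)
have psum A : \sum_e p e A <= 2.
  rewrite /p; under eq_bigr do rewrite big_mkcond.
  rewrite -(bigA_distr_bigA (fun j b => if j != i then f b j A else 1)).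
  rewrite (bigD1 i)//= big_bool eqxx /= big1 ?mulr1//.
  by move=> j ji; rewrite big_bool /= ji f1.
have mB e : measurable (B i e) by exact: measurable_loo_bad.
pose h e A := p e A * \1_(B i e) A.
have mh e : measurable_fun setT (h e).
  by apply: measurable_funM => //; exact: measurable_indic.
have h0 e A : 0 <= h e A by rewrite mulr_ge0// indicE.
rewrite bad_loo_cover; apply: le_trans (measure_exists_le _ _ (measurable_cover i)) _.
apply: (@le_trans _ _ (\sum_e \int[P]_w (h e (X w))%:E)%E).
  apply: lee_sum => e _.
  apply: le_trans (_ : P (E e `&` X @^-1` B i e) <= _)%E; first exact: lexx.
  rewrite ((cond (fun j => ~~ e j)).2 _ (mB e)).
  have mXB : measurable (X @^-1` B i e).
    by have := measurable_funP X measurableT _ (mB e); rewrite setTI.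
  rewrite integral_mkcond; apply: ge0_le_integral => //.
  - move=> w _; rewrite /patch; case: ifP => // _; rewrite lee_fin.
    by apply: prodr_ge0 => j _; have := f01 (e j) j (X w); rewrite /f; case/andP.
  - apply: (iffLR (measurable_restrictT _ mXB)); apply/measurable_EFinP.
    apply: measurable_funTS; apply: (measurableT_comp (cond (fun j => ~~ e j)).1).
    exact: measurable_funP.
  - apply/measurable_EFinP; apply: measurableT_comp (mh e) _; exact: measurable_funP.
  move=> w _; rewrite /patch; case: ifPn => [wB|_]; last by rewrite lee_fin.
  rewrite lee_fin /h indicE.
  have -> : X w \in B i e by move: wB; rewrite !inE.
  rewrite mulr1 (bigD1 i)//= ler_piMl//; first exact: p0.
  by have := f01 (e i) i (X w); rewrite /f; case/andP.
rewrite -ge0_integral_sum//; last 2 first.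
  by move=> e; apply/measurable_EFinP; apply: measurableT_comp (mh e) _; exact: measurable_funP.
  by move=> e w _; rewrite lee_fin.
under eq_integral do rewrite sumEFin.
rewrite (@integral_law (fun A => (\sum_e h e A)%:E)); last 2 first.
  by apply/measurable_EFinP; exact: measurable_sum.
  by move=> A; rewrite lee_fin sumr_ge0.
apply: loo_bad_prob => // e A A' AA'.
by apply: eq_bigr => j ji; rewrite /f AA'.
Qed.

(** With no other example the interpolator is zero. This case is separate because [ln 1 = 0] leaves
    nothing to absorb the factor 4. *)
Lemma bad_loo1 i : n = 1%N -> bad_loo i = set0.
Proof.
move=> n1; apply/seteqP; split => w //= [D0 _].
have z : zero_col i (Y w) = 0.
  apply/rowP => j; rewrite !mxE; case: eqP => // ji; exfalso; apply: ji.
  have v0 (l : 'I_n) : l = 0%N :> nat.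
    by apply/eqP; rewrite -leqn0 -ltnS -[X in (_ < X)%N]n1.
  by apply/val_inj; rewrite /= !v0.
by rewrite /loo_vec z !mul0mx {1}/dot mul0mx mxE normr0 normr_le0 (negbTE D0).
Qed.

Lemma bad_loos_prob : (P [set w | exists2 i, true & bad_loo i w] <=
  (expR (- (1 / 2048) * (m / d%:R) * (eff_dim lambda / n%:R) + 35 * ln n%:R))%:E)%E.
Proof.
have nR : 0 < (n%:R : R) by rewrite ltr0n.
have [n1|n1] := eqVneq n 1%N.
  rewrite (_ : [set w | _] = set0) ?measure0 ?lee_fin ?expR_ge0//.
  by apply/seteqP; split => w //= [i _]; rewrite bad_loo1.
have n2 : (2 <= n)%N by rewrite ltn_neqAle eq_sym n1.
apply: le_trans (measure_exists_le _ _ measurable_bad_loo) _.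
apply: (@le_trans _ _ (\sum_(i < n) (4 * expR (- (32 * (d%:R / m * L * V))^-1))%:E)%E).
  by apply: lee_sum => i _; exact: bad_loo_prob.
rewrite sumEFin lee_fin sumr_const card_ord -[_ *+ _]mulr_natl.
rewrite addrC expRD expRM_natl lnK ?posrE//.
(* The rate is [1 / (32 * 64)]: 32 from the linear tail and 64 from the eigenvalue bound inside
   [V]. *)
have -> : (32 * (d%:R / m * L * V))^-1 =
    1 / 2048 * (m / d%:R) * (eff_dim lambda / n%:R).
  rewrite /V /eff_dim -/t -/L; field.
  by rewrite !gt_eqF ?ltr0n.
rewrite !mulNr mulrA ler_wpM2r ?expR_ge0//.
have n2R : 2 <= (n%:R : R) by rewrite ler_nat.
(* [4 n <= n^3], because [n >= 2] here. *)
apply: (@le_trans _ _ (n%:R ^+ 3)); first by nra.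
by rewrite ler_weXn2l// ler1n.
Qed.

Lemma sv_prob :
  ((1 - expR (- (1 / 2048) * eff_dim lambda + 35 * n%:R)
      - expR (- (1 / 2048) * (m / d%:R) * (eff_dim lambda / n%:R) + 35 * ln n%:R))%:E
   <= P SV)%E.
Proof.
have mS := measurable_sv.
have mN : measurable bad_net.
  rewrite /bad_net (_ : [set w | _] = [set w | exists k : seq_sub (enum (@net n)),
      qform_bad lambda (net_vec R (val k)) (X w)]).
    apply: measurable_set_exists => k.
    have := measurable_funP X measurableT _
      (@measurable_qform_bad R n d lambda (net_vec R (val k))).
    by rewrite setTI.
  apply/seteqP; split => w /= [k].
    by rewrite -mem_enum => kn bk; exists (SeqSub kn).
  by move=> bk; exists (val k) => //; rewrite -mem_enum; exact: valP.
have mL : measurable [set w | exists2 i, true & bad_loo i w].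
  rewrite (_ : [set w | _] = [set w | exists i, bad_loo i w]).
    exact: measurable_set_exists measurable_bad_loo.
  by apply/seteqP; split => w /= [i]; exists i.
have := le_measure P (_ : ~` SV \in measurable) (_ : bad_net `|` _ \in measurable) sv_compl_sub.
rewrite !inE => /(_ (measurableC mS) (measurableU _ _ mN mL)).
move=> /le_trans /(_ (measureU2 _ mN mL)) /le_trans /(_ (leeD bad_net_prob bad_loos_prob)).
rewrite [X in (X <= _)%E](_ : _ = 1 - P SV)%E; last exact: probability_setC.
rewrite -EFinD -(fineK (fin_num_measure P _ mS)) -EFinB !lee_fin; lra.
Qed.

End Model.

Theorem theorem2 (R : realType) :
  exists C c : R, 0 < C /\ 0 < c /\
  forall (d n : nat) (hn : (1 <= n)%N) (hnd : (n <= d)%N) (lambda : 'rV[R]_d),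
    (forall j, 0 < lambda ord0 j) ->
  forall (disp : measure_display) (T : measurableType disp)
    (P : probability T R) (X : {RV P >-> measurable_mx R n d})
    (y : 'I_n -> {RV P >-> R}),
    haar_features hnd lambda X ->
    label_model X y ->
    ((1 - expR (- c * eff_dim lambda + C * n%:R)
        - expR (- c * ((d%:R - n%:R + 1) / d%:R) * (eff_dim lambda / n%:R)
                + C * ln n%:R))%:E
     <= P [set w | forall i, support_vector (X w) (\row_k y k w) i])%E.
Proof.
(* 35 is dictated by the size of the net, 2048 by the leave-one-out tail. *)
exists 35, (1 / 2048); split; first lra; split; first lra.
move=> d n hn hnd lambda lambda_gt0 disp T P X y [mu haar lawX] labels.
exact: (sv_prob hn lambda_gt0 haar lawX labels).
Qed.
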